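(* Let $\Omega$ be a bounded Lipschitz domain in $\mathbb{R}^N$ or $\Omega=\mathbb{R}^N$. Let $s\in(0,1)$ and let $p\in C(\overline{\Omega}\times\overline{\Omega})$ be uniformly continuous and symmetric (i.e. $p(x,y)=p(y,x)$) such that $$1<\inf_{(x,y)\in\overline\Omega\times\overline\Omega}p(x,y)\le\sup_{(x,y)\in\overline\Omega\times\overline\Omega}p(x,y)<\frac{N}{s}.$$ Assume furthermore that $p$ satisfies the log-Hölder type continuity condition $$\inf_{\varepsilon>0}\ \sup_{(x,y)\in\Omega\times\Omega,\ 0<|x-y|<1/2}\ \left|p(x,y)-p^-_{\Omega_{x,\varepsilon}\times\Omega_{y,\varepsilon}}\right|\log\frac{1}{|x-y|}<\infty,$$ where $\Omega_{z,\varepsilon}:=B_\varepsilon(z)\cap\Omega$ for $z\in\Omega$, $\varepsilon>0$, and $p^-_{\Omega_{x,\varepsilon}\times\Omega_{y,\varepsilon}}:=\inf_{(x',y')\in\Omega_{x,\varepsilon}\times\Omega_{y,\varepsilon}}p(x',y')$. Let $q\in C_+(\overline\Omega)$ be such that for any $x\in\Omega$ there exists $\varepsilon=\varepsilon(x)>0$ with $$\sup_{y\in\Omega_{x,\varepsilon}}q(y)\le\frac{N\inf_{(y,z)\in\Omega_{x,\varepsilon}\times\Omega_{x,\varepsilon}}p(y,z)}{N-s\inf_{(y,z)\in\Omega_{x,\varepsilon}\times\Omega_{x,\varepsilon}}p(y,z)},$$ and, in addition, when $\Omega=\mathbb{R}^N$, $q$ is uniformly continuous and $p(x,x)<q(x)$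 for all $x\in\mathbb{R}^N$. Then there is a continuous imbedding $$W^{s,p(\cdot,\cdot)}(\Omega)\hookrightarrow L^{q(\cdot)}(\Omega).$$
   Context: $B_\varepsilon(z)$ is the ball in $\mathbb{R}^N$ centered at $z$ with radius $\varepsilon$. $C_+(\overline\Omega)$ is the set of $h\in C(\overline\Omega)$ with $1<\inf_{\overline\Omega}h\le\sup_{\overline\Omega}h<\infty$. For $h\in C_+(\overline\Omega)$, $L^{h(\cdot)}(\Omega)$ is the space of measurable $u:\Omega\to\mathbb{R}$ with $\int_\Omega|u(x)|^{h(x)}\,dx<\infty$, with the Luxemburg norm $\|u\|_{L^{h(\cdot)}(\Omega)}=\inf\{\lambda>0:\int_\Omega|u(x)/\lambda|^{h(x)}dx\le1\}$. Write $p(x):=p(x,x)$. The space $W^{s,p(\cdot,\cdot)}(\Omega)$ is the set of $u\in L^{p(\cdot)}(\Omega)$ with $\int_\Omega\int_\Omega\frac{|u(x)-u(y)|^{p(x,y)}}{|x-y|^{N+sp(x,y)}}\,dx\,dy<\infty$, with norm $\|u\|_{s,p,\Omega}:=\inf\{\lambda>0:M_\Omega(u/\lambda)<1\}$, where $M_\Omega(u):=\int_\Omega|u|^{p(x)}dx+\int_\Omega\int_\Omega\frac{|u(x)-u(y)|^{p(x,y)}}{|x-y|^{N+sp(x,y)}}\,dx\,dy$. It is a separable reflexive Banach space. *)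

(* Defs.v *)
From HB Require Import structures.
From mathcomp Require Import all_boot all_order all_algebra.
From mathcomp Require Import all_classical all_reals all_analysis.

Set Implicit Arguments.
Unset Strict Implicit.
Unset Printing Implicit Defensive.

Import Order.TTheory GRing.Theory Num.Theory.
Import numFieldNormedType.Exports.

Local Open Scope classical_set_scope.
Local Open Scope ring_scope.

(* The points of R^N are row vectors.  The norm that the library puts on
   'rV[R]_N is the sup norm, whence the separate Euclidean norm below; both
   induce the same topology and the same uniform structure. *)

Section Euclidean.
Context {R : realType} {N : nat}.
Implicit Types (x z : 'rV[R]_N) (Omega : set 'rV[R]_N).

Definition enorm x : R := Num.sqrt (\sum_(i < N) x ord0 i ^+ 2).

Definition eball z (e : R) : set 'rV[R]_N := [set x | enorm (x - z) < e].

End Euclidean.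

Section Lipschitz_domain.
Context {R : realType} {N : nat}.
Implicit Types Omega : set 'rV[R]_N.

Definition domain Omega := [/\ open Omega, connected Omega & Omega !=set0].

(* Near each boundary point, in suitable orthonormal coordinates y = x *m Q,
   Omega is the region lying strictly above the graph of a Lipschitz function
   of the coordinates of y other than the j-th one (col' j y). *)
Definition lipschitz_boundary Omega :=
  forall x0, (closure Omega `\` Omega°) x0 ->
  exists (r : R) (Q : 'M[R]_N) (j : 'I_N) (gamma : 'rV[R]_N.-1 -> R) (k : R),
    [/\ 0 < r, Q *m Q^T = 1%:M,
        forall a b, `|gamma a - gamma b| <= k * enorm (a - b) &
        forall x, eball x0 r x ->
          Omega x <-> gamma (col' j (x *m Q)) < (x *m Q) ord0 j].

Definition bounded_lipschitz_domain Omega :=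
  [/\ domain Omega, exists M : R, Omega `<=` eball 0 M &
      lipschitz_boundary Omega].

End Lipschitz_domain.

(* The product sigma-algebra on R^n, generated by the coordinates, as the
   library does for n.-tuple R. *)

Definition rV_display : measure_display -> measure_display.
Proof. exact. Qed.

Section measurable_rV.
Context {R : realType} {n : nat}.

Definition rV_coord (i : 'I_n) (x : 'rV[R]_n) : measurableTypeR R := x ord0 i.

Let rV_set0 : g_sigma_preimage rV_coord set0.
Proof. exact: sigma_algebra0. Qed.

Let rV_setC A : g_sigma_preimage rV_coord A -> g_sigma_preimage rV_coord (~` A).
Proof. exact: sigma_algebraC. Qed.

Let rV_bigcup (F : (set 'rV[R]_n)^nat) :
  (forall i, g_sigma_preimage rV_coord (F i)) ->
  g_sigma_preimage rV_coord (\bigcup_i (F i)).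
Proof. exact: sigma_algebra_bigcup. Qed.

HB.instance Definition _ := @isMeasurable.Build
  (rV_display default_measure_display)
  'rV[R]_n (g_sigma_preimage rV_coord) rV_set0 rV_setC rV_bigcup.

End measurable_rV.

Lemma measurable_fun_rVP d (T : measurableType d) (R : realType) n
    (f : T -> 'rV[R]_n) :
  measurable_fun setT f <->
  forall i, measurable_fun setT (fun t => f t ord0 i : measurableTypeR R).
Proof.
apply: (@iff_trans _ (g_sigma_preimage (fun i => rV_coord i \o f)
    `<=` measurable)).
  rewrite (@g_sigma_preimage_comp _ _ _ _ (@rV_coord R n)); split=> [mf A [/= C preC <-]|prefS].
    exact: mf.
  by move=> _ A mA; apply: prefS; exists A.
split=> [fS i|mf].
- move=> _ A mA; apply: fS; apply: sub_sigma_algebra.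
  case: n i => [[] []//|n i] in f *.
  rewrite -bigcup_mkord_ord; exists i; first exact: ltn_ord.
  by exists A => //; rewrite inord_val.
- apply: smallest_sub; first exact: sigma_algebra_measurable.
  case: n => [|n] in f mf *; first by rewrite big_ord0.
  rewrite -bigcup_mkord_ord; apply: bigcup_sub => i Ii.
  by move=> A [B mB <-]; exact: mf.
Qed.

Lemma measurable_rV_coord (R : realType) n (i : 'I_n) :
  measurable_fun setT (@rV_coord R n i).
Proof.
move: i; apply: (proj1 (@measurable_fun_rVP _ _ R n (@idfun 'rV[R]_n))).
exact: measurable_id.
Qed.

Section lebesgue_measure_rV.
Context {R : realType}.
Local Open Scope ereal_scope.

Definition rV_cons n (xv : measurableTypeR R * 'rV[R]_n) : 'rV[R]_n.+1 :=
  row_mx (xv.1)%:M xv.2.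

Definition rV_step n (mu : set 'rV[R]_n -> \bar R) :
    set 'rV[R]_n.+1 -> \bar R :=
  pushforward (lebesgue_measure \x mu) (@rV_cons n).

Fixpoint lebesgue_measure_rV n : set 'rV[R]_n -> \bar R :=
  if n is m.+1 then rV_step (@lebesgue_measure_rV m)
  else dirac (0%R : 'rV[R]_0).

Lemma rV_cons0 n xv : @rV_cons n xv ord0 ord0 = xv.1.
Proof.
have -> : (ord0 : 'I_n.+1) = lshift n (ord0 : 'I_1) by exact: val_inj.
by rewrite (row_mxEl (xv.1)%:M) mxE eqxx.
Qed.

Lemma rV_consS n xv (i : 'I_n) : @rV_cons n xv ord0 (lift ord0 i) = xv.2 ord0 i.
Proof.
have -> : lift ord0 i = rshift 1 i by exact: val_inj.
by rewrite (row_mxEr (xv.1)%:M).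
Qed.

Lemma measurable_rV_cons n : measurable_fun setT (@rV_cons n).
Proof.
apply/measurable_fun_rVP => i.
have [j ->|->] := unliftP ord0 i.
- rewrite (_ : (fun _ => _) = rV_coord j \o snd); last first.
    by apply/funext => xv /=; rewrite rV_consS.
  by apply: measurableT_comp; [exact: measurable_rV_coord|exact: measurable_snd].
- rewrite (_ : (fun _ => _) = fst); first exact: measurable_fst.
  by apply/funext => xv /=; rewrite rV_cons0.
Qed.

Definition rV_uncons n (w : 'rV[R]_n.+1) : measurableTypeR R * 'rV[R]_n :=
  (w ord0 ord0, \row_i w ord0 (lift ord0 i)).

Lemma rV_consK n : cancel (@rV_cons n) (@rV_uncons n).
Proof.
move=> [x v]; rewrite /rV_uncons rV_cons0; congr pair.
by apply/rowP => i; rewrite mxE rV_consS.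
Qed.

Lemma rV_unconsK n : cancel (@rV_uncons n) (@rV_cons n).
Proof.
move=> w; apply/rowP => i.
by have [j ->|->] := unliftP ord0 i; rewrite ?rV_consS ?rV_cons0 ?mxE.
Qed.

Lemma measurable_rV_uncons n : measurable_fun setT (@rV_uncons n).
Proof.
apply: measurable_fun_pair; first exact: measurable_rV_coord.
apply/measurable_fun_rVP => i /=.
rewrite (_ : (fun _ => _) = rV_coord (lift ord0 i)); last first.
  by apply/funext => w; rewrite mxE.
exact: measurable_rV_coord.
Qed.

Section step.
Variables (n : nat) (mu : {sigma_finite_measure set 'rV[R]_n -> \bar R}).

Let m := rV_step mu.

Let m0 : m set0 = 0.
Proof. by rewrite /m /rV_step /pushforward preimage_set0 measure0. Qed.

Let m_ge0 A : 0 <= m A.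
Proof. by rewrite /m /rV_step /pushforward measure_ge0. Qed.

Let m_sigma_additive : semi_sigma_additive m.
Proof.
have mcons A : measurable A -> measurable (@rV_cons n @^-1` A).
  by move=> mA; rewrite -[X in measurable X]setTI; exact: measurable_rV_cons.
move=> F mF tF mUF; rewrite /m /rV_step /pushforward preimage_bigcup.
apply: measure_semi_sigma_additive.
- by move=> k; exact: mcons.
- apply/trivIsetP => /= i j _ _ ij; rewrite -preimage_setI.
  by move/trivIsetP : tF => /(_ _ _ _ _ ij) ->//; rewrite preimage_set0.
- by rewrite -preimage_bigcup; exact: mcons.
Qed.

HB.instance Definition _ := isMeasure.Build _ _ _ (rV_step mu)
  m0 m_ge0 m_sigma_additive.

Let m_sigma_finite : sigma_finite setT m.
Proof.
have /sigma_finiteP[F [TF ndF Foo]] := sigma_finiteT (@lebesgue_measure R).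
have /sigma_finiteP[G [TG ndG Goo]] := sigma_finiteT mu.
exists (fun k => @rV_uncons n @^-1` (F k `*` G k)).
  rewrite -preimage_bigcup -(preimage_setT (@rV_uncons n)); congr (_ @^-1` _).
  rewrite -setXTT TF TG predeqE => -[x y]; split.
    move=> [/= [i _ Fix] [k _ Gky]]; exists (maxn i k) => //; split.
    - by move: x Fix; exact/subsetPset/ndF/leq_maxl.
    - by move: y Gky; exact/subsetPset/ndG/leq_maxr.
  by move=> [i _ []/= ? ?]; split; exists i.
move=> k; have [mF Fk] := Foo k; have [mG Gk] := Goo k; split.
  rewrite -[X in measurable X]setTI; apply: measurable_rV_uncons => //.
  exact: measurableX.
rewrite /m /rV_step /pushforward -comp_preimage (_ : _ \o _ = id); last first.
  by apply/funext => xv /=; rewrite rV_consK.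
by rewrite preimage_id product_measure1E// lte_mul_pinfty// ge0_fin_numE.
Qed.

HB.instance Definition _ := Measure_isSigmaFinite.Build _ _ _ (rV_step mu)
  m_sigma_finite.

End step.

Lemma lebesgue_measure_rV_ex n :
  exists mu : {sigma_finite_measure set 'rV[R]_n -> \bar R},
    lebesgue_measure_rV (n := n) = mu.
Proof.
elim: n => [|n [mu IH]] /=; first by exists (dirac (0%R : 'rV[R]_0)).
by exists (rV_step mu); rewrite IH.
Qed.

Section instances.
Variable n : nat.
Let lam : set 'rV[R]_n -> \bar R := @lebesgue_measure_rV n.

Let lam0 : lam set0 = 0.
Proof. by rewrite /lam; have [mu ->] := lebesgue_measure_rV_ex n. Qed.

Let lam_ge0 A : 0 <= lam A.
Proof. by rewrite /lam; have [mu ->] := lebesgue_measure_rV_ex n. Qed.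

Let lam_sigma_additive : semi_sigma_additive lam.
Proof.
rewrite /lam; have [mu ->] := lebesgue_measure_rV_ex n.
exact: measure_semi_sigma_additive.
Qed.

HB.instance Definition _ := isMeasure.Build _ _ _ (@lebesgue_measure_rV n)
  lam0 lam_ge0 lam_sigma_additive.

Let lam_sigma_finite : sigma_finite setT lam.
Proof.
rewrite /lam; have [mu ->] := lebesgue_measure_rV_ex n.
exact: sigma_finiteT.
Qed.

HB.instance Definition _ := Measure_isSigmaFinite.Build _ _ _
  (@lebesgue_measure_rV n) lam_sigma_finite.

End instances.

Lemma measurable_rV_box n (A : 'I_n -> set (measurableTypeR R)) :
  (forall i, measurable (A i)) ->
  measurable [set x : 'rV[R]_n | forall i, A i (x ord0 i)].
Proof.
move=> mA; rewrite (_ : [set _ | _] = \bigcap_(i in setT) rV_coord i @^-1` A i).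
  apply: fin_bigcap_measurable; first exact: finite_finset.
  by move=> i _; rewrite -[X in measurable X]setTI; exact: measurable_rV_coord.
by apply/seteqP; split => [x Ax i _|x Ax i]; [exact: Ax|exact: Ax].
Qed.

Lemma lebesgue_measure_rV_box n (A : 'I_n -> set (measurableTypeR R)) :
  (forall i, measurable (A i)) ->
  lebesgue_measure_rV [set x : 'rV[R]_n | forall i, A i (x ord0 i)] =
  \prod_(i < n) lebesgue_measure (A i).
Proof.
elim: n A => [|n IH] A mA.
  by rewrite big_ord0 /= diracE mem_set//= => -[].
rewrite big_ord_recl -IH// -product_measure1E//; last first.
  by apply: (@measurable_rV_box n (A \o lift ord0)) => i; exact: mA.
rewrite [LHS]/= /rV_step /pushforward; congr (_ _).
apply/seteqP; split => [[x v] /= H|[x v] /= [H1 H2] i].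
  split; first by have := H ord0; rewrite rV_cons0.
  by move=> i; have := H (lift ord0 i); rewrite rV_consS.
by have [j ->|->] := unliftP ord0 i; rewrite ?rV_consS ?rV_cons0.
Qed.

End lebesgue_measure_rV.

Arguments lebesgue_measure_rV {R n}.

Section variable_exponent_spaces.
Context {R : realType} {N : nat}.
Implicit Types (Omega : set 'rV[R]_N) (h : 'rV[R]_N -> R).
Implicit Types (p : 'rV[R]_N * 'rV[R]_N -> R) (u : 'rV[R]_N -> R).

Local Notation mu := (@lebesgue_measure_rV R N).

(* C_+(closure Omega); the bounds are taken in \bar R because the real-valued
   sup of an unbounded set is 0. *)
Definition Cplus Omega h :=
  [/\ {within closure Omega, continuous h},
      (1%:E < ereal_inf [set (h x)%:E | x in closure Omega])%E &
      (ereal_sup [set (h x)%:E | x in closure Omega] < +oo)%E].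

(* An element of one of the function spaces below is given by a Borel
   measurable representative; only its values on Omega matter. *)

Definition modular_L Omega h u : \bar R :=
  (\int[mu]_(x in Omega) (`|u x| `^ h x)%:E)%E.

Definition Lvar Omega h : set ('rV[R]_N -> R) :=
  [set u | measurable_fun Omega u /\ (modular_L Omega h u < +oo)%E].

Definition Lvar_norm Omega h u : R :=
  inf [set lambda : R | 0 < lambda /\
    (modular_L Omega h (fun x => (u x / lambda)%R) <= 1)%E].

Definition gagliardo (s : R) Omega p u : \bar R :=
  (\int[mu]_(y in Omega) \int[mu]_(x in Omega)
    (`|u x - u y| `^ p (x, y) /
     enorm (x - y) `^ (N%:R + s * p (x, y)))%:E)%E.

Definition diag p : 'rV[R]_N -> R := fun x => p (x, x).

Definition modular_W (s : R) Omega p u : \bar R :=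
  (modular_L Omega (diag p) u + gagliardo s Omega p u)%E.

Definition Wvar (s : R) Omega p : set ('rV[R]_N -> R) :=
  [set u | Lvar Omega (diag p) u /\ (gagliardo s Omega p u < +oo)%E].

Definition Wvar_norm (s : R) Omega p u : R :=
  inf [set lambda : R | 0 < lambda /\
    (modular_W s Omega p (fun x => (u x / lambda)%R) < 1)%E].

Definition log_hoelder_sup Omega p (eps : R) : \bar R :=
  ereal_sup [set
    (`|p z - inf (p @` ((eball z.1 eps `&` Omega) `*`
                        (eball z.2 eps `&` Omega)))| *
     ln (1 / enorm (z.1 - z.2)))%:E
  | z in [set z | [/\ Omega z.1, Omega z.2,
                      0 < enorm (z.1 - z.2) & enorm (z.1 - z.2) < 1 / 2]]].

Definition log_hoelder Omega p :=
  (ereal_inf [set log_hoelder_sup Omega p eps | eps in [set e : R | (0 < e)%R]]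
   < +oo)%E.

End variable_exponent_spaces.

(* X and Y are spaces of functions on the same domain, with norms normX and
   normY: the inclusion of X into Y is well defined and bounded. *)
Definition continuous_imbedding (R : realType) (T : Type)
    (X : set (T -> R)) (normX : (T -> R) -> R)
    (Y : set (T -> R)) (normY : (T -> R) -> R) :=
  X `<=` Y /\
  exists C : R, 0 < C /\ forall u, X u -> normY u <= C * normX u.

(* Main.v *)
Require Import Defs.
From HB Require Import structures.
From mathcomp Require Import all_boot all_order all_algebra.
From mathcomp Require Import all_classical all_reals all_analysis.
From mathcomp Require Import measurable_realfun lra ring.

Set Implicit Arguments.
Unset Strict Implicit.
Unset Printing Implicit Defensive.

Import Order.TTheory GRing.Theory Num.Theory.
Import numFieldNormedType.Exports.

Local Open Scope classical_set_scope.
Local Open Scope ring_scope.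

(* In the log-Hoelder condition the radius eps is fixed while y tends to x, so
   p(x,x) <= p(x',y') for all x', y' close to x.  Hence p(x,x) is locally
   constant, thus equal to a constant P on the connected set Omega;
   p(x,y) >= P near the diagonal, and q <= r := N P / (N - s P).

   It remains to bound the integral of |u|^r when the modular of u is at most
   1.  Omega satisfies a corkscrew condition (a ball of radius e t inside both
   Omega and B(y,t)).  Let g(y) be the inner Gagliardo integral at y and K an
   upper bound of the integral of |u|^r.  By Chebyshev that ball contains a
   point x at which both the Gagliardo kernel and |u|^r are at most a constant
   times their averages, so that
     |u(y)|^P <= C (t^(s P) (g(y) + 1) + (K / t^N)^(P / r)).
   Optimizing in t yields |u(y)|^r <= C K^(s P / N) (g(y) + 1), and integrating,
   K <= C K^(s P / N), which bounds K because s P < N.  The truncations of u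
   make K finite. *)

(** * Integrals of possibly non-measurable nonnegative functions *)

(* The integral of a nonnegative function is a supremum over simple functions,
   so it is monotone and homogeneous without measurability; this dispenses with
   the measurability of the integrands involving p and q. *)
Section lower_integral.
Context d (T : measurableType d) (R : realType).
Variables (mu : {measure set T -> \bar R}) (D : set T).
Local Open Scope ereal_scope.
Import HBNNSimple.

Lemma le_integral_scale (f g : T -> \bar R) (k : R) : (0 < k)%R ->
  (forall x, D x -> 0 <= f x) -> (forall x, D x -> f x <= k%:E * g x) ->
  \int[mu]_(x in D) f x <= k%:E * \int[mu]_(x in D) g x.
Proof.
move=> k0 f0 fg.
have g0 x : D x -> 0 <= g x.
  by move=> Dx; rewrite -(@pmule_rge0 _ k%:E) ?lte_fin// (le_trans (f0 _ Dx)) ?fg.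
rewrite !ge0_integralE//; apply: ge_ereal_sup => _ [h hf <-].
have kV0 : (0 <= k^-1)%R by rewrite invr_ge0 ltW.
(* Dividing a simple function below [f] by [k] gives one below [g]; off [D] such a function must
   vanish. *)
have h'g x : (scale_nnsfun h kV0 x)%:E <= (g \_ D) x.
  rewrite /= EFinM; move: (hf x); rewrite /patch; case: ifPn => xD hx.
    rewrite lee_pdivrMl//; apply: (le_trans hx); apply: fg; exact/set_mem.
  have -> : h x = 0%R by apply/eqP; rewrite eq_le -lee_fin hx /=.
  by rewrite mule0.
have -> : sintegral mu h = k%:E * sintegral mu (scale_nnsfun h kV0).
  rewrite -sintegralrM; apply: eq_sintegral => x /=.
  by rewrite mulVKf// gt_eqF.
by rewrite lee_pmul2l//; apply: ereal_sup_ubound; exists (scale_nnsfun h kV0).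
Qed.

Lemma le_lower_integral (f g : T -> \bar R) :
  (forall x, D x -> 0 <= f x) -> (forall x, D x -> f x <= g x) ->
  \int[mu]_(x in D) f x <= \int[mu]_(x in D) g x.
Proof.
move=> f0 fg; rewrite -[leRHS]mul1e; apply: le_integral_scale => // x Dx.
by rewrite mul1e fg.
Qed.

(** Chebyshev's inequality, valid even if [F] is not measurable: on [D] the indicator of [A] is at
    most [F / a], and the lower integral is monotone. *)
Lemma markov_lower (F : T -> R) (A : set T) (a G : R) :
  measurable A -> A `<=` D -> measurable D ->
  (forall x, D x -> 0 <= F x)%R -> (0 < a)%R -> (forall x, A x -> a <= F x)%R ->
  \int[mu]_(x in D) (F x)%:E <= G%:E -> mu A <= (G / a)%:E.
Proof.
move=> mA AD mD F0 a0 aF FG.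
rewrite -(setIidl AD) -integral_indic// EFinM muleC.
apply: le_trans (_ : a^-1%:E * \int[mu]_(x in D) (F x)%:E <= _); last first.
  by rewrite lee_pmul2l// lte_fin invr_gt0.
apply: le_integral_scale; first by rewrite invr_gt0.
  by move=> x _; rewrite lee_fin.
move=> x Dx; rewrite -EFinM lee_fin indicE; have [|] := boolP (x \in A).
  by rewrite inE => /aF; rewrite ler_pdivlMl ?mulr1.
by rewrite mulr_ge0 ?invr_ge0 ?(ltW a0) ?F0.
Qed.

(** If every point of [A] failed, [A] would split into the part where [h] exceeds its threshold and
    the rest, where [F] exceeds its own. By Chebyshev each part has measure at most [m / 3], which
    is too little. Cutting along [h] alone keeps both parts measurable. *)
Lemma exists_le_average (F h : T -> R) (A : set T) (m G H : R) :
  measurable D -> measurable A -> A `<=` D -> mu A = m%:E -> (0 < m)%R ->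
  measurable_fun A h ->
  (forall x, D x -> 0 <= F x)%R -> (forall x, D x -> 0 <= h x)%R ->
  (0 < G)%R -> (0 < H)%R ->
  \int[mu]_(x in D) (F x)%:E <= G%:E -> \int[mu]_(x in D) (h x)%:E <= H%:E ->
  exists x, [/\ A x, (F x <= 3 * G / m)%R & (h x <= 3 * H / m)%R].
Proof.
move=> mD mA AD muA m0 mh F0 h0 G0 H0 FG hH; apply: contrapT => noP.
pose b := (3 * H / m)%R; pose A2 := A `&` h @^-1` `]b, +oo[; pose A1 := A `\` A2.
have mA2 : measurable A2 by exact: mh.
have mA1 : measurable A1 by exact: measurableD.
have b0 : (0 < b)%R by rewrite divr_gt0 ?mulr_gt0.
have a0 : (0 < 3 * G / m)%R by rewrite divr_gt0 ?mulr_gt0.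
have le2 : mu A2 <= (H / b)%:E.
  apply: (@markov_lower h) => //; first by move=> x [/AD].
  by move=> x [_] /=; rewrite in_itv/= andbT => /ltW.
have le1 : mu A1 <= (G / (3 * G / m))%:E.
  apply: (@markov_lower F) => //; first by move=> x [/AD].
  move=> x [Ax nA2x]; rewrite leNgt; apply/negP => Fx; apply: noP.
  exists x; split => //; first exact: ltW.
  rewrite leNgt; apply/negP => hx; apply: nA2x; split => //=.
  by rewrite in_itv/= andbT.
have : mu A <= mu A1 + mu A2.
  rewrite -[X in mu X](setDUK (_ : A2 `<=` A)); last by move=> x [].
  by rewrite setUC; apply: measureU2.
rewrite muA leNgt => /negP; apply; apply: le_lt_trans (leeD le1 le2) _.
rewrite -EFinD lte_fin /b.
have -> : (G / (3 * G / m) = m / 3)%R by field; rewrite (gt_eqF m0) (gt_eqF G0).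
have -> : (H / (3 * H / m) = m / 3)%R by field; rewrite (gt_eqF m0) (gt_eqF H0).
lra.
Qed.

End lower_integral.

(** * Interpolation and absorption of powers *)

Section absorption.
Context {R : realType}.
Implicit Types (C K G w sigma t : R).

(** Optimization over the scale: the growing and the decaying term of the first bound are balanced,
    and the second bound takes over when the balancing scale exceeds [R1]. *)
Lemma interpolation_bound C (R1 : R) sigma : 0 < sigma < 1 -> 0 < C -> 0 < R1 ->
  exists2 C2, 0 < C2 & forall w G K, 0 <= w -> 1 <= G -> 1 <= K ->
  (forall t, 0 < t <= R1 -> w <= C * (t `^ sigma * G + (K / t) `^ (1 - sigma))) ->
  (forall t, 0 < t <= R1 -> w <= C * (t `^ sigma * G + t^-1)) ->
  w `^ (1 - sigma)^-1 <= C2 * (K `^ sigma * G).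
Proof.
move=> /andP[s0 s1] C0 R10; set tau := 1 - sigma.
have tau0 : 0 < tau by rewrite subr_gt0.
have tauV : 0 <= tau^-1 by rewrite invr_ge0 ltW.
pose D := C * (R1 `^ sigma + R1^-1).
have D0 : 0 < D by rewrite mulr_gt0// addr_gt0 ?powR_gt0 ?invr_gt0.
exists ((2 * C) `^ tau^-1 + D `^ tau^-1 * R1^-1 `^ (sigma / tau)).
  by apply: addr_gt0; [|apply: mulr_gt0];
    apply: powR_gt0; [exact: mulr_gt0|exact: D0|rewrite invr_gt0].
move=> w G K w0 G1 K1 h1 h2.
have G0 : 0 < G by lra.
have K0 : 0 < K by lra.
have KG0 : 0 <= K `^ sigma * G by rewrite mulr_ge0 ?powR_ge0 ?ltW.
(* This value makes [t ^ sigma * G] and [(K / t) ^ tau] equal. *)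
pose t := K `^ tau / G.
have t0 : 0 < t by rewrite divr_gt0 ?powR_gt0.
rewrite mulrDl; have [tR|tR] := leP t R1.
  apply: (@le_trans _ _ ((2 * C) `^ tau^-1 * (K `^ sigma * G))); last first.
    by rewrite lerDl mulr_ge0// mulr_ge0 ?powR_ge0.
  have -> : (2 * C) `^ tau^-1 * (K `^ sigma * G) =
      (2 * C * (t `^ sigma * G)) `^ tau^-1.
    rewrite [RHS]powRM ?mulr_ge0 ?powR_ge0 ?(ltW C0) ?(ltW G0)//; congr (_ * _).
    rewrite /t [(K `^ tau / G) `^ sigma]powRM ?powR_ge0 ?invr_ge0 ?(ltW G0)// -mulrA.
    have -> : G^-1 `^ sigma * G = G `^ tau.
      rewrite -powR_inv1 ?ltW// -powRrM -[X in _ * X]powRr1 ?ltW// -powRD.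
        by congr (_ `^ _); rewrite /tau; lra.
      by rewrite (gt_eqF G0) implybT.
    rewrite powRM ?powR_ge0// -!powRrM mulrCA.
    by rewrite divff ?gt_eqF// mulr1 powRr1// ltW.
  apply: ge0_ler_powR => //; rewrite ?nnegrE ?mulr_ge0 ?powR_ge0 ?(ltW C0) ?(ltW G0)//.
  apply: (le_trans (h1 t _)); first by rewrite t0.
  suff -> : (K / t) `^ tau = t `^ sigma * G.
    by rewrite le_eqVlt; apply/orP; left; apply/eqP; ring.
  rewrite powRM ?invr_ge0 ?(ltW K0) ?(ltW t0)//.
  have -> : K `^ tau = t * G by rewrite /t divfK// gt_eqF.
  rewrite mulrAC; congr (_ * _); rewrite -powR_inv1 ?ltW// -powRrM.
  rewrite -[X in X * _]powRr1 ?ltW// -powRD; last by rewrite (gt_eqF t0) implybT.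
  by congr (_ `^ _); rewrite /tau; lra.
apply: (@le_trans _ _ (D `^ tau^-1 * R1^-1 `^ (sigma / tau) * (K `^ sigma * G)));
    last first.
  by rewrite lerDr mulr_ge0// powR_ge0.
(* The balancing scale is out of range, so the second bound is used at [R1]. There [R1 < t] means
   [G < K ^ tau / R1], which pays for the surplus power [G ^ (sigma / tau)] below. *)
have wDG : w <= D * G.
  apply: (le_trans (h2 R1 _)); first by rewrite R10 lexx.
  rewrite /D -mulrA; apply: ler_wpM2l; first exact: ltW.
  by rewrite mulrDl lerD2l ler_peMr// invr_ge0 ltW.
apply: (@le_trans _ _ ((D * G) `^ tau^-1)).
  by apply: ge0_ler_powR => //; rewrite nnegrE//; exact: mulr_ge0 (ltW D0) (ltW G0).
rewrite powRM ?(ltW D0) ?(ltW G0)// -mulrA; apply: ler_wpM2l; first exact: powR_ge0.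
rewrite [X in G `^ X](_ : tau^-1 = 1 + sigma / tau); last first.
  have -> : sigma = 1 - tau by rewrite /tau subKr.
  by rewrite mulrBl mul1r divff ?gt_eqF// addrC subrK.
rewrite powRD; last by rewrite (gt_eqF G0) implybT.
rewrite powRr1 ?(ltW G0)// [leRHS]mulrA [leRHS]mulrC.
apply: ler_wpM2l; first exact: ltW.
have -> : K `^ sigma = (K `^ tau) `^ (sigma / tau).
  by rewrite -powRrM mulrC divfK// gt_eqF.
rewrite -powRM ?powR_ge0 ?invr_ge0 ?(ltW R10)//.
apply: ge0_ler_powR; rewrite ?nnegrE ?(ltW G0)//.
- by rewrite divr_ge0 ?ltW.
- by rewrite mulr_ge0 ?powR_ge0 ?invr_ge0 ?(ltW R10).
by rewrite mulrC ler_pdivlMr// mulrC -ler_pdivlMr// ltW.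
Qed.

(** This closes the self-referential bound on the critical integral: dividing by [K ^ sigma] leaves
    [K ^ (1 - sigma) <= C]. *)
Lemma absorb_power C K sigma : 0 < sigma < 1 -> 0 < C -> 1 <= K ->
  K <= C * K `^ sigma -> K <= C `^ (1 - sigma)^-1.
Proof.
move=> /andP[s0 s1] C0 K1 h.
have K0 : 0 < K by lra.
have tau0 : 0 < 1 - sigma by lra.
have hK : K `^ (1 - sigma) <= C.
  have -> : K `^ (1 - sigma) = K / K `^ sigma.
    rewrite powRB ?powRr1 ?(ltW K0)// (gt_eqF K0); exact: implybT.
  by rewrite ler_pdivrMr ?powR_gt0.
rewrite -[leLHS]powRr1 ?(ltW K0)// -[X in _ `^ X](divff (lt0r_neq0 tau0)) powRrM.
by apply: ge0_ler_powR => //; rewrite ?nnegrE ?powR_ge0 ?invr_ge0 ?(ltW C0) ?(ltW tau0).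
Qed.

End absorption.

(** * Euclidean norm and Lebesgue measure on row vectors *)

Section enorm_theory.
Context {R : realType} {N : nat}.
Implicit Types (x y z : 'rV[R]_N).

Lemma coord_le_norm x i : `|x ord0 i| <= `|x|.
Proof.
rewrite [leRHS]/Num.norm /= mx_normrE; apply/bigmax_geP; right.
by exists (ord0, i).
Qed.

Lemma norm_le_coord x (e : R) : 0 <= e -> (forall i, `|x ord0 i| <= e) -> `|x| <= e.
Proof.
move=> e0 h; rewrite [leLHS]/Num.norm /= mx_normrE; apply/bigmax_leP.
by split=> // -[i j] _ /=; rewrite ord1.
Qed.

Lemma enorm_ge0 x : 0 <= enorm x. Proof. exact: sqrtr_ge0. Qed.

Lemma sum_sqr_ge0 x : 0 <= \sum_(i < N) x ord0 i ^+ 2.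
Proof. by apply: sumr_ge0 => i _; exact: sqr_ge0. Qed.

Lemma coord_le_enorm x i : `|x ord0 i| <= enorm x.
Proof.
rewrite -sqrtr_sqr ler_sqrt ?sum_sqr_ge0// (bigD1 i)//= lerDl.
by apply: sumr_ge0 => j _; exact: sqr_ge0.
Qed.

Lemma norm_le_enorm x : `|x| <= enorm x.
Proof. by apply: norm_le_coord; [exact: enorm_ge0|exact: coord_le_enorm]. Qed.

Lemma enorm_le_norm x : enorm x <= N%:R * `|x|.
Proof.
have h0 : 0 <= N%:R * `|x| by rewrite mulr_ge0.
rewrite -[leRHS]ger0_norm// -sqrtr_sqr ler_sqrt ?sqr_ge0//.
apply: (@le_trans _ _ (\sum_(i < N) `|x| ^+ 2)).
  by apply: ler_sum => i _; rewrite -[leLHS]real_normK ?num_real//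
    lerXn2r ?nnegrE// coord_le_norm.
rewrite sumr_const card_ord -[X in X <= _]mulr_natl exprMn -natrX.
rewrite ler_wpM2r ?sqr_ge0// ler_nat.
by case: (N) => // n; rewrite expnS expn1 leq_pmulr.
Qed.

Lemma enorm_eq0 x : enorm x = 0 -> x = 0.
Proof.
move=> x0; apply/eqP; rewrite -normr_eq0 -[_ == 0]andTb eq_le normr_ge0 andbT.
by rewrite -x0 norm_le_enorm.
Qed.

Lemma enormN x : enorm (- x) = enorm x.
Proof. by congr Num.sqrt; apply: eq_bigr => i _; rewrite mxE sqrrN. Qed.

Lemma sqr_enormE x : (x *m x^T) ord0 ord0 = \sum_(i < N) x ord0 i ^+ 2.
Proof. by rewrite mxE; apply: eq_bigr => i _; rewrite mxE expr2. Qed.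

Lemma enorm_orthogonal x (Q : 'M[R]_N) : Q *m Q^T = 1%:M -> enorm (x *m Q) = enorm x.
Proof.
move=> QQ; rewrite /enorm -!sqr_enormE trmx_mul mulmxA -(mulmxA x) QQ.
by rewrite mulmx1.
Qed.

Lemma enorm_delta i : enorm (delta_mx ord0 i : 'rV[R]_N) = 1.
Proof.
rewrite /enorm (bigD1 i)//= mxE !eqxx big1 ?expr1n ?addr0 ?sqrtr1// => j ji.
by rewrite mxE (negbTE ji) andbF expr0n.
Qed.

Lemma ball_rVE x e : ball x e = [set y : 'rV[R]_N | `|x - y| < e].
Proof. by rewrite mx_norm_ball. Qed.

Lemma ball_rV_boxE x e : 0 < e ->
  ball x e = [set y : 'rV[R]_N | forall i,
    (`](x ord0 i - e), (x ord0 i + e)[%classic : set (measurableTypeR R)) (y ord0 i)].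
Proof.
move=> e0; rewrite predeqE => y; split => [[_ xy] i|xy] /=.
  have := xy ord0 i; rewrite /ball/= in_itv/= ltr_distlC.
  by rewrite -ltr_distl distrC ltr_distl.
split=> // i j; rewrite ord1 /ball/=; have /= := xy j; rewrite in_itv/=.
by rewrite ltr_distlC => /andP[? ?]; apply/andP; split.
Qed.

Lemma measurable_ball_rV x e : measurable (ball x e : set 'rV[R]_N).
Proof.
have [e0|e0] := ltP 0 e; last first.
  suff -> : ball x e = set0 by exact: measurable0.
  by rewrite -subset0 => y [/=]; rewrite ltNge e0.
rewrite ball_rV_boxE//.
by apply: (@measurable_rV_box _ _ (fun i => `]x ord0 i - e, x ord0 i + e[%classic)) => i.
Qed.

Lemma lebesgue_measure_rV_ball x e : 0 < e ->
  lebesgue_measure_rV (ball x e) = ((2 * e) ^+ N)%:E.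
Proof.
move=> e0; rewrite ball_rV_boxE//.
rewrite (lebesgue_measure_rV_box (A := fun i => `]x ord0 i - e, x ord0 i + e[%classic)).
  rewrite (eq_bigr (fun=> (2 * e)%:E)).
    by rewrite -(@big_morph _ _ EFin 1%E *%E 1 *%R)// prodr_const card_ord.
  move=> i _; rewrite lebesgue_measure_itv/= lte_fin ifT; last lra.
  by rewrite -EFinB; congr EFin; ring.
by move=> i; exact: measurable_itv.
Qed.

(** An open set is a countable union of balls with rational centre and radius [1 / (k + 1)], and
    sup-norm balls are boxes. *)
Lemma measurable_open_rV (A : set 'rV[R]_N) : open A -> measurable A.
Proof.
move=> oA.
pose c (q : 'rV[rat]_N) : 'rV[R]_N := map_mx ratr q.
pose I := [set qk : 'rV[rat]_N * nat | ball (c qk.1) qk.2.+1%:R^-1 `<=` A].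
have -> : A = \bigcup_(qk in I) ball (c qk.1) qk.2.+1%:R^-1.
  apply/seteqP; split => [x Ax|x [[q k] /= h xq]]; last exact: h.
  have /nbhs_ballP[e /= e0 xeA] : nbhs x A by exact: open_nbhs_nbhs.
  have [k ke] : exists k : nat, k.+1%:R^-1 < e / 2.
    have e20 : 0 < e / 2 by lra.
    exists (Num.trunc (e / 2)^-1); rewrite invf_plt ?posrE//.
    exact: truncnS_gt.
  have k0 : 0 < k.+1%:R^-1 :> R by rewrite invr_gt0.
  have /choice[q qP] : forall i, exists q : rat, `|ratr q - x ord0 i| < k.+1%:R^-1.
    move=> i; have [|q] :=
      @rat_in_itvoo R (x ord0 i - k.+1%:R^-1) (x ord0 i + k.+1%:R^-1).
      by rewrite ltrBlDr -addrA ltrDl addr_gt0.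
    by rewrite in_itv/= => qx; exists q; rewrite ltr_distl.
  have xq : ball (c (\row_i q i)) k.+1%:R^-1 x.
    by split=> // i j; rewrite ord1 /ball /= !mxE.
  exists (\row_i q i, k) => //= y qy; apply: xeA.
  rewrite [e]splitr; apply: (@ball_triangle _ _ (c (\row_i q i))).
    by apply: ball_sym; apply: le_ball xq; exact: ltW.
  by apply: le_ball qy; exact: ltW.
rewrite bigcup_mkcond; apply: countable_bigcupT_measurable; first exact: countableP.
by move=> qk; case: ifPn => _; [exact: measurable_ball_rV|exact: measurable0].
Qed.

End enorm_theory.

Lemma enorm_col' {R : realType} {N : nat} (x : 'rV[R]_N) j : enorm (col' j x) <= enorm x.
Proof.
rewrite /enorm ler_sqrt ?sum_sqr_ge0//.
case: N x j => [x [] //|n x j].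
rewrite [leRHS](bigD1_ord j)//= ; under eq_bigr do rewrite mxE.
by rewrite lerDr sqr_ge0.
Qed.

(** * The corkscrew condition *)

Section corkscrew.
Context {R : realType} {N : nat}.
Implicit Types (Omega : set 'rV[R]_N) (x y z : 'rV[R]_N).

(** The balls are sup-norm balls, that is cubes of explicit measure. A single [e] limits both the
    scales and the ratio of the radii, so that it can be shrunk freely in the compactness
    argument. *)
Definition corkscrew_at Omega (e : R) y :=
  forall t, 0 < t <= e -> exists z, ball z (e * t) `<=` Omega `&` ball y t.

Definition corkscrew Omega := exists2 e : R, 0 < e & Omega `<=` corkscrew_at Omega e.

Lemma corkscrew_at_le Omega e e' y : 0 < e' -> e' <= e ->
  corkscrew_at Omega e y -> corkscrew_at Omega e' y.
Proof.
move=> e'0 e'e h t /andP[t0 te']; have [|z zP] := h t.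
  by rewrite t0 (le_trans te').
exists z; apply: subset_trans zP; apply: le_ball.
by rewrite ler_wpM2r// ltW.
Qed.

Lemma corkscrewT : corkscrew setT.
Proof.
exists 1 => // y _ t t0; exists y; rewrite mul1r => z yz; by split.
Qed.

Lemma corkscrew_near_interior Omega x0 : open Omega -> Omega x0 ->
  exists2 e : R, 0 < e & forall y, ball x0 e y -> corkscrew_at Omega e y.
Proof.
move=> oO Ox0; have /nbhs_ballP[r /= r0 rO] : nbhs x0 Omega by exact: open_nbhs_nbhs.
exists (Num.min 1 (r / 2)); first by rewrite lt_min ltr01 divr_gt0.
move=> y xy t /andP[t0]; rewrite le_min => /andP[t1 tr]; exists y => z yz.
have {}yz : ball y t z.
  by apply: le_ball yz; rewrite ger_pMl// ge_min lexx.
split=> //; apply: rO; rewrite [r]splitr; apply: (@ball_triangle _ _ y).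
  by apply: le_ball xy; rewrite ge_min lexx orbT.
exact: le_ball yz.
Qed.

(** Lifting [y] by [t / 2] away from the graph leaves room for a ball of radius proportional to [t],
    because inside that ball a Lipschitz graph rises by at most a multiple of the radius. *)
Lemma corkscrew_near_boundary Omega x0 : lipschitz_boundary Omega ->
  (closure Omega `\` Omega°) x0 ->
  exists2 e : R, 0 < e & forall y, ball x0 e y -> Omega y -> corkscrew_at Omega e y.
Proof.
move=> lip /lip[r [Q [j [gamma [k [r0 QQ gammaL chart]]]]]].
have N0 : 0 < N%:R :> R by rewrite ltr0n (leq_ltn_trans _ (ltn_ord j)).
(* In a ball of radius [kappa * t], the rise of the graph and the vertical displacement together
   stay below [N * kappa * t * (|k| + 1)], which is exactly the lift [t / 2]. The factor [N] passes
   from the sup norm to the Euclidean norm. *)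
pose kappa : R := (2 * N%:R * (`|k| + 1))^-1.
have D0 : 0 < 2 * N%:R * (`|k| + 1) by rewrite !mulr_gt0// ltr_wpDl.
have kappa0 : 0 < kappa by rewrite invr_gt0.
have kappaE : N%:R * kappa * (`|k| + 1) = 2^-1.
  rewrite /kappa; field; rewrite !gt_eqF//; exact: ltr_wpDl.
have kappa2 : kappa <= 2^-1.
  rewrite -kappaE (mulrC N%:R) -mulrA ler_peMr ?(ltW kappa0)//.
  rewrite -[X in X <= _]mulr1 ler_pM// ?ler1n ?lerDr// -(ltr0n R).
  by rewrite N0.
pose e := Num.min kappa (r / (2 * N%:R)).
have e0 : 0 < e by rewrite lt_min kappa0 divr_gt0// mulr_gt0.
exists e => // y xy Oy t /andP[t0 te].
have Nt : N%:R * (e + e) <= r.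
  have : e <= r / (2 * N%:R) by rewrite /e ge_min lexx orbT.
  rewrite ler_pdivlMr ?mulr_gt0// => h.
  apply: le_trans h; lra.
have ballyt w : ball y t w -> eball x0 r w.
  move=> yw; have xw : ball x0 (e + e) w.
    by apply: (@ball_triangle _ _ y) => //; exact: le_ball yw.
  rewrite /eball /=; apply: (le_lt_trans (enorm_le_norm _)).
  apply: lt_le_trans Nt; rewrite ltr_pM2l// distrC.
  by move: xw; rewrite ball_rVE.
have yb : ball y t y by exact: ballxx.
have QTQ : Q^T *m Q = 1%:M by apply: mulmx1C.
(* The vertical unit vector of the chart, written in the original coordinates. *)
pose v : 'rV[R]_N := delta_mx ord0 j *m Q^T.
have v1 : `|v| <= 1.
  rewrite (le_trans (norm_le_enorm _))// enorm_orthogonal ?enorm_delta//.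
  by rewrite trmxK.
exists (y + (t / 2) *: v) => w.
rewrite ball_rVE /= => wz.
pose d := w - (y + (t / 2) *: v).
have dlt : `|d| < kappa * t.
  rewrite /d distrC (lt_le_trans wz)// ler_wpM2r ?(ltW t0)//.
  by rewrite /e ge_min lexx.
have wE : w = y + (t / 2) *: v + d by rewrite /d addrC subrK.
have yw : ball y t w.
  rewrite ball_rVE /= distrC wE -(addrA y) (addrC y) addrK.
  apply: (le_lt_trans (ler_normD _ _)); rewrite [ltRHS]splitr.
  apply: ler_ltD.
    by rewrite normrZ gtr0_norm ?divr_gt0// ler_piMr// ltW// divr_gt0.
  by rewrite (lt_le_trans dlt)// mulrC ler_wpM2l ?(ltW t0).
split=> //.
have wQ : w *m Q = y *m Q + (t / 2) *: delta_mx ord0 j + d *m Q.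
  by rewrite wE !mulmxDl -scalemxAl /v -mulmxA QTQ mulmx1.
have dQ : enorm (d *m Q) < N%:R * kappa * t.
  rewrite enorm_orthogonal// (le_lt_trans (enorm_le_norm _))// -mulrA.
  by rewrite ltr_pM2l.
have wQj : (w *m Q) ord0 j = (y *m Q) ord0 j + t / 2 + (d *m Q) ord0 j.
  by rewrite wQ !mxE !eqxx mulr1.
(* The lift changes only the [j]-th coordinate, so the argument of [gamma] moves by the displacement
   [d] alone. *)
have wQj' : col' j (w *m Q) - col' j (y *m Q) = col' j (d *m Q).
  rewrite wQ; apply/rowP => i; rewrite !mxE.
  by rewrite [lift j i == j]eq_sym (negbTE (neq_lift _ _)) andbF
    mulr0 addr0 [LHS]addrC addKr.
apply/chart; first exact: ballyt.
have yP := (chart _ (ballyt _ yb)).1 Oy.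
have gd : gamma (col' j (w *m Q)) - gamma (col' j (y *m Q)) <=
    `|k| * (N%:R * kappa * t).
  apply: (le_trans (ler_norm _)); apply: (le_trans (gammaL _ _)); rewrite wQj'.
  apply: (le_trans (ler_wpM2r (enorm_ge0 _) (ler_norm k))).
  by rewrite ler_wpM2l// (le_trans (enorm_col' _ _))// ltW.
have dj : - (N%:R * kappa * t) < (d *m Q) ord0 j.
  have := le_lt_trans (coord_le_enorm (d *m Q) j) dQ.
  by rewrite ltr_norml => /andP[].
rewrite wQj.
have : `|k| * (N%:R * kappa * t) + N%:R * kappa * t = t / 2.
  by rewrite -[X in _ + X]mul1r -mulrDl mulrC mulrAC kappaE mulrC.
lra.
Qed.

Lemma closure_bounded_rV Omega (M : R) : Omega `<=` eball 0 M ->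
  closure Omega `<=` [set x | `|x| <= M].
Proof.
move=> OM; have cl : closed [set x : 'rV[R]_N | `|x| <= M].
  apply: (@closed_comp _ _ (fun x : 'rV[R]_N => `|x|) [set r | r <= M]).
    by move=> x _; exact: norm_continuous.
  exact: closed_le.
move/closure_id : cl => ->; apply: closure_subset => x /OM /=.
by rewrite /eball /= subr0 => /ltW; apply: le_trans; exact: norm_le_enorm.
Qed.

(** Interior and boundary points each have a neighbourhood with its own [e]; compactness of the
    closure yields one [e] for all. *)
Lemma corkscrew_lipschitz Omega : bounded_lipschitz_domain Omega -> corkscrew Omega.
Proof.
move=> [[oO _ _] [M OM] lip].
have clM := closure_bounded_rV OM.
have cO : compact (closure Omega).
  apply: bounded_closed_compact; last exact: closed_closure.
  exists M; split; first exact: num_real.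
  by move=> m Mm x /clM /= xM; rewrite (le_trans xM)// ltW.
have : \forall e \near (0 : R)^'+, closure Omega `<=`
    [set y | Omega y -> corkscrew_at Omega e y].
  apply: (compact_near_coveringP _).1 => // x0 clx0.
  have [e e0 eP] : exists2 e : R, 0 < e &
      forall y, ball x0 e y -> Omega y -> corkscrew_at Omega e y.
    have [Ox0|nOx0] := pselect (Omega x0).
      have [e e0 eP] := corkscrew_near_interior oO Ox0.
      by exists e => // y xy _; exact: eP.
    apply: corkscrew_near_boundary => //; split=> //.
    by move/interior_subset.
  exists (ball x0 e, [set e' | 0 < e' <= e]); first split => /=.
  - exact: nbhsx_ballx.
  - near=> e'; apply/andP; split; near: e'.
      exact: nbhs_right_gt.
    exact: nbhs_right_le.
  by move=> [y e'] /= [xy /andP[e'0 e'e]] Oy; apply: (corkscrew_at_le e'0 e'e); exact: eP.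
move=> h; near (0 : R)^'+ => e.
exists e; first by near: e; exact: nbhs_right_gt.
have eP : closure Omega `<=` [set y | Omega y -> corkscrew_at Omega e y] by near: e.
by move=> y Oy; apply: eP => //; exact: subset_closure.
Unshelve. all: by end_near. Qed.

End corkscrew.

(** * The critical Sobolev bound *)

Section powR_bounds.
Context {R : realType}.
Implicit Types (a b t rho n s P p M : R).

Lemma powRD_le a b P : 0 <= a -> 0 <= b -> 0 <= P ->
  (a + b) `^ P <= 2 `^ P * (a `^ P + b `^ P).
Proof.
move=> a0 b0 P0; wlog ab : a b a0 b0 / a <= b.
  move=> H; have [/H|/ltW/H] := leP a b; first exact.
  by rewrite addrC [X in _ -> _ <= _ * X]addrC; exact.
apply: (@le_trans _ _ ((2 * b) `^ P)).
  by apply: ge0_ler_powR => //; rewrite ?nnegrE; lra.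
by rewrite powRM// ler_wpM2l ?powR_ge0// lerDr powR_ge0.
Qed.

Lemma powR_le1D a P p : 0 <= a -> 0 <= P -> P <= p -> a `^ P <= 1 + a `^ p.
Proof.
move=> a0 P0 Pp; have [a1|a1] := leP a 1.
  have : a `^ P <= 1 `^ P by apply: ge0_ler_powR; rewrite ?nnegrE.
  by rewrite powR1 => /le_trans; apply; rewrite lerDl powR_ge0.
have : a `^ P <= a `^ p by rewrite ler_powR// ltW.
by move/le_trans; apply; rewrite lerDr.
Qed.

Lemma dist_min_le a b c : `|Num.min a c - Num.min b c| <= `|a - b|.
Proof.
wlog ab : a b / a <= b.
  by move=> H; have [/H//|/ltW/H] := leP a b; rewrite distrC [X in _ <= X -> _]distrC.
rewrite (distrC a) (distrC (Num.min a c)) [leRHS]ger0_norm ?subr_ge0//.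
by case: (leP a c); case: (leP b c) => *; rewrite ler_norml; apply/andP; split; lra.
Qed.

(* The increment is compared at the scale [rho `^ s]: there a larger exponent
   only costs an additive constant. *)
Lemma increment_bound a rho t n s P p M : 0 <= a -> 0 < t -> 0 < n -> 0 < s ->
  0 <= P -> P <= p -> 0 <= rho <= n * t -> (rho = 0 -> a = 0) -> 0 <= M ->
  a `^ p / rho `^ (n + s * p) <= M / t `^ n ->
  a `^ P <= (1 + M * n `^ n) * n `^ (s * P) * t `^ (s * P).
Proof.
move=> a0 t0 n0 s0 P0 Pp /andP[rho0 rhont] rhoa M0 h.
(* Treated apart because [0 ^ 0] is 1, which would spoil the case [rho = 0]. *)
have [sP0|sPn0] := eqVneq P 0.
  rewrite sP0 mulr0 !powRr0 !mulr1 lerDl mulr_ge0 ?powR_ge0//.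
have Pgt0 : 0 < P by rewrite lt_neqAle eq_sym sPn0.
have RHS0 : 0 <= (1 + M * n `^ n) * n `^ (s * P) * t `^ (s * P).
  by rewrite !mulr_ge0 ?powR_ge0// addr_ge0 ?mulr_ge0 ?powR_ge0.
have [rho00|rhon0] := eqVneq rho 0.
  by rewrite (rhoa rho00) powR0.
have rhogt0 : 0 < rho by rewrite lt_neqAle eq_sym rhon0.
(* In terms of this quotient the kernel is [b ^ p / rho ^ n], and [rho <= n * t] turns its bound
   into [b ^ p <= M * n ^ n], free of [t]. *)
pose b := a / rho `^ s.
have rs0 : 0 < rho `^ s by exact: powR_gt0.
have b0 : 0 <= b by rewrite divr_ge0 ?powR_ge0.
have aE : a = b * rho `^ s by rewrite divfK ?gt_eqF.
have bp : b `^ p <= M * n `^ n.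
  have : b `^ p * rho `^ (- n) <= M / t `^ n.
    move: h; rewrite aE powRM ?powR_ge0// -powRrM powRD; last first.
      by rewrite (gt_eqF rhogt0) implybT.
    have X0 : rho `^ (s * p) != 0 by rewrite gt_eqF ?powR_gt0.
    have Y0 : rho `^ n != 0 by rewrite gt_eqF ?powR_gt0.
    rewrite powRN; congr (_ <= _); field; by rewrite X0 Y0.
  rewrite powRN ler_pdivrMr ?powR_gt0// => /le_trans; apply.
  rewrite -mulrA ler_wpM2l// mulrC ler_pdivrMr ?powR_gt0// -powRM ?(ltW n0) ?(ltW t0)//.
  by apply: ge0_ler_powR; rewrite ?nnegrE ?mulr_ge0 // ltW.
have bP : b `^ P <= 1 + M * n `^ n.
  by apply: (le_trans (powR_le1D b0 P0 Pp)); rewrite lerD2l.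
rewrite aE powRM ?powR_ge0// -powRrM -mulrA ler_pM ?powR_ge0//.
rewrite -powRM ?(ltW n0) ?(ltW t0)//; apply: ge0_ler_powR;
  rewrite ?nnegrE ?mulr_ge0//; exact: ltW.
Qed.

End powR_bounds.

Section critical_estimate.
Context {R : realType} {N : nat}.
Variables (Omega : set 'rV[R]_N) (s P eps : R) (p : 'rV[R]_N * 'rV[R]_N -> R).
Hypotheses (N0 : (0 < N)%N) (mO : measurable Omega) (corkO : corkscrew Omega).
Hypotheses (s0 : 0 < s) (P1 : 1 <= P) (sPN : s * P < N%:R) (eps0 : 0 < eps).
Hypothesis pP : forall x y, Omega x -> Omega y -> enorm (x - y) < eps -> P <= p (x, y).

Local Notation mu := (@lebesgue_measure_rV R N).
(** With this notation [P / (1 - sigma)] is the critical Sobolev exponent [N P / (N - s P)]. *)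
Let sigma := s * P / N%:R.

Let gkernel (u : 'rV[R]_N -> R) y x :=
  `|u x - u y| `^ p (x, y) / enorm (x - y) `^ (N%:R + s * p (x, y)).

Let n0 : 0 < N%:R :> R. Proof. by rewrite ltr0n. Qed.

Let sigma01 : 0 < sigma < 1.
Proof.
have P0 : 0 < P by rewrite (lt_le_trans ltr01).
by rewrite divr_gt0 ?mulr_gt0//= ltr_pdivrMr// mul1r.
Qed.

Lemma gkernel_ge0 u x y : 0 <= gkernel u y x.
Proof. by rewrite divr_ge0 ?powR_ge0. Qed.

(* Chebyshev on the ball of measure comparable to [T] supplied by the
   corkscrew condition. *)
Lemma scale_bound : exists C b R1 : R, [/\ 0 < C, 0 < b, 0 < R1 &
  forall (u v : 'rV[R]_N -> R) y (G : R),
  measurable_fun Omega v -> (forall x, Omega x -> 0 <= v x) ->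
  (forall x, Omega x -> `|v x - v y| <= `|u x - u y|) ->
  Omega y -> 1 <= G -> (\int[mu]_(x in Omega) (gkernel u y x)%:E <= G%:E)%E ->
  forall T, 0 < T <= R1 -> forall m K, 0 < m -> 0 < K ->
  (\int[mu]_(x in Omega) (v x `^ (P / m))%:E <= K%:E)%E ->
  v y `^ P <= C * (T `^ sigma * G + (b * (K / T)) `^ m)].
Proof.
have [e e0 cork] := corkO.
pose n : R := N%:R.
pose c : R := (2 * e) `^ n.
have c0 : 0 < c by rewrite powR_gt0// mulr_gt0.
(* Below this scale the corkscrew ball exists and its points lie within Euclidean distance [eps] of
   [y], where [P] bounds [p] from below. *)
pose e1 := Num.min e (eps / n).
have e10 : 0 < e1 by rewrite lt_min e0 divr_gt0.
pose C0 := (1 + 3 / c * n `^ n) * n `^ (s * P).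
have C00 : 0 < C0.
  rewrite mulr_gt0 ?powR_gt0// ltr_wpDr// mulr_ge0 ?powR_ge0// divr_ge0// ltW//.
have P0 : 0 <= P by exact: le_trans ler01 P1.
exists (2 `^ P * (C0 + 1)), (3 / c), (e1 `^ n); split.
- by rewrite mulr_gt0 ?powR_gt0 ?addr_gt0.
- by rewrite divr_gt0.
- exact: powR_gt0.
move=> u v y G mv v0 vu Oy G1 gG T /andP[T0 TR] m K m0 K0 vK.
(* [T] measures the scale by volume and [t] by length, so that the corkscrew ball has measure
   [c * T]. *)
pose t := T `^ n^-1.
have t0 : 0 < t by exact: powR_gt0.
have tn : t `^ n = T by rewrite -powRrM mulVf ?gt_eqF// powRr1// ltW.
have te1 : t <= e1.
  have -> : e1 = (e1 `^ n) `^ n^-1 by rewrite -powRrM mulfV ?gt_eqF// powRr1// ltW.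
  by apply: ge0_ler_powR; rewrite ?nnegrE ?powR_ge0 ?invr_ge0 ?(ltW T0).
have [|z zP] := cork y Oy t; first by rewrite t0 (le_trans te1)// ge_min lexx.
have et0 : 0 < e * t by exact: mulr_gt0.
have muA : mu (ball z (e * t)) = (c * T)%:E.
  rewrite lebesgue_measure_rV_ball//; congr EFin.
  by rewrite mulrA -powR_mulrn ?mulr_ge0 ?(ltW e0) ?(ltW t0)//
    powRM ?mulr_ge0 ?(ltW e0) ?(ltW t0)// tn.
have AO : ball z (e * t) `<=` Omega by move=> x /zP[].
have mA : measurable (ball z (e * t)) by exact: measurable_ball_rV.
(* One point [x] serves twice: the kernel controls the increment from [x] to [y], and the second
   average controls [v x]. The free [m] allows as input either the critical integral or the integral
   of [v ^ P]. *)
have [|x [Ax Fx hx]] := exists_le_average mO mA AO muA (mulr_gt0 c0 T0) _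
  (fun x _ => gkernel_ge0 u x y) (fun x _ => powR_ge0 (v x) (P / m))
  (lt_le_trans ltr01 G1) K0 gG vK.
  apply: (measurable_funS mO AO).
  exact: (@measurableT_comp _ _ _ _ _ _ (@powR R ^~ (P / m))).
have [Ox yx] := zP _ Ax.
have rho_le : enorm (x - y) <= n * t.
  apply: (le_trans (enorm_le_norm _)); rewrite ler_wpM2l// ltW//.
  by move: yx; rewrite ball_rVE /= distrC.
have rho_lt : enorm (x - y) < eps.
  rewrite (@lt_le_trans _ _ (n * t))//; last first.
    rewrite mulrC -ler_pdivlMr// (le_trans te1)// ge_min lexx orbT//.
  apply: (le_lt_trans (enorm_le_norm _)); rewrite ltr_pM2l//.
  by move: yx; rewrite ball_rVE /= distrC.
have duP : `|u x - u y| `^ P <= C0 * (T `^ sigma * G).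
  have -> : T `^ sigma = t `^ (s * P) by rewrite /t -powRrM mulrC.
  apply: (le_trans (@increment_bound _ _ (enorm (x - y)) t n s P (p (x, y))
     (3 * G / c) _ _ _ _ _ _ _ _ _ _)) => //.
  - exact: pP.
  - by rewrite enorm_ge0.
  - by move=> /enorm_eq0/eqP; rewrite subr_eq0 => /eqP->; rewrite subrr normr0.
  - by rewrite divr_ge0 ?mulr_ge0 ?ltW//; lra.
  - by rewrite tn -mulrA -invfM.
  rewrite mulrA [leRHS]mulrAC ler_wpM2r ?powR_ge0//.
  rewrite /C0 -[leRHS]mulrAC ler_wpM2r ?powR_ge0//.
  by rewrite (mulrAC 3) (mulrAC (3 / c)) [leRHS]mulrDl [X in _ <= X + _]mul1r lerD2r.
have vxP : v x `^ P <= (3 / c * (K / T)) `^ m.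
  have -> : v x `^ P = (v x `^ (P / m)) `^ m by rewrite -powRrM divfK// gt_eqF.
  apply: ge0_ler_powR; rewrite ?nnegrE ?powR_ge0 ?(ltW m0)//.
    by rewrite mulr_ge0 ?divr_ge0// ltW.
  by rewrite mulrACA -invfM.
have vyle : v y <= v x + `|u x - u y|.
  have := vu _ Ox; have := ler_norm (v y - v x); rewrite distrC; lra.
have : v y `^ P <= 2 `^ P * (v x `^ P + `|u x - u y| `^ P).
  apply: le_trans (powRD_le _ _ _) => //; last exact: v0.
  by apply: ge0_ler_powR => //; rewrite nnegrE ?addr_ge0 ?v0.
move=> /le_trans; apply.
rewrite -mulrA ler_wpM2l ?powR_ge0// mulrDr addrC lerD//.
  by rewrite (le_trans duP)// ler_wpM2r ?mulr_ge0 ?powR_ge0//; lra.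
by rewrite (le_trans vxP)// ler_peMl ?powR_ge0//; lra.
Qed.


(** The two hypotheses of the interpolation come from the same scale estimate, taken with
    [m = 1 - sigma] and the critical integral, then with [m = 1] and the integral of [v ^ P]. *)
Lemma pointwise_bound : exists2 C : R, 0 < C &
  forall (u v : 'rV[R]_N -> R) y (G K : R),
  measurable_fun Omega v -> (forall x, Omega x -> 0 <= v x) ->
  (forall x, Omega x -> `|v x - v y| <= `|u x - u y|) ->
  Omega y -> 1 <= G -> (\int[mu]_(x in Omega) (gkernel u y x)%:E <= G%:E)%E ->
  (\int[mu]_(x in Omega) (v x `^ P)%:E <= 1)%E -> 1 <= K ->
  (\int[mu]_(x in Omega) (v x `^ (P / (1 - sigma)))%:E <= K%:E)%E ->
  v y `^ (P / (1 - sigma)) <= C * (K `^ sigma * G).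
Proof.
have [C [b [R1 [C0 b0 R10 scale]]]] := scale_bound.
have tau0 : 0 < 1 - sigma by rewrite subr_gt0; case/andP: sigma01.
pose C' := C * (1 + b `^ (1 - sigma) + b).
have bt0 : 0 <= b `^ (1 - sigma) by exact: powR_ge0.
have C'0 : 0 < C' by rewrite mulr_gt0// ltr_wpDl// ltW// addr_gt0 ?powR_gt0.
have [C2 C20 interp] := interpolation_bound sigma01 C'0 R10.
exists C2 => // u v y G K mv v0 vu Oy G1 gG vP K1 vK.
have G0 : 0 < G by exact: lt_le_trans G1.
have K0 : 0 < K by exact: lt_le_trans K1.
have C'E (X Y c : R) : 0 <= X -> 0 <= Y -> 0 <= c -> c <= 1 + b `^ (1 - sigma) + b ->
    C * (X + c * Y) <= C' * (X + Y).
  move=> X0 Y0 cge0 cle; rewrite -mulrA ler_wpM2l ?(ltW C0)// mulrDr lerD//.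
    by rewrite ler_peMl// -addrA lerDl addr_ge0// ltW.
  by rewrite ler_wpM2r.
rewrite powRrM; apply: interp => //; first exact: powR_ge0.
  move=> T T0R; apply: (le_trans (scale u v y G mv v0 vu Oy G1 gG T T0R _ _ tau0 K0 vK)).
  have /andP[T0 _] := T0R.
  rewrite powRM ?divr_ge0 ?(ltW b0) ?(ltW K0) ?(ltW T0)//; apply: C'E => //.
  - by rewrite mulr_ge0 ?powR_ge0 ?(ltW G0).
  - exact: powR_ge0.
  - by rewrite -addrA addrCA lerDl addr_ge0// ltW.
move=> T T0R; have /andP[T0 _] := T0R.
apply: le_trans (scale u v y G mv v0 vu Oy G1 gG T T0R 1 1 ltr01 ltr01 _) _.
  by under eq_integral do rewrite divr1.
rewrite mul1r powRr1 ?divr_ge0 ?mulr_ge0 ?invr_ge0 ?(ltW b0) ?(ltW T0)//.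
apply: C'E; rewrite ?invr_ge0 ?mulr_ge0 ?powR_ge0 ?(ltW b0) ?(ltW T0) ?(ltW G0)//.
by rewrite lerDr addr_ge0.
Qed.

(** The height [k] only serves to make the critical integral finite, so that it can be absorbed; the
    resulting constant does not depend on [k]. *)
Lemma truncation_bound : exists2 C : R, 0 < C &
  forall (u v : 'rV[R]_N -> R) (k : R),
  measurable_fun Omega v -> (forall x, Omega x -> 0 <= v x <= k) ->
  (forall x y, Omega x -> Omega y -> `|v x - v y| <= `|u x - u y|) ->
  (\int[mu]_(x in Omega) (v x `^ P)%:E <= 1)%E ->
  (gagliardo s Omega p u <= 1)%E ->
  (\int[mu]_(x in Omega) (v x `^ (P / (1 - sigma)))%:E <= C%:E)%E.
Proof.
have [C C0 ptw] := pointwise_bound.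
have /andP[sg0 sg1] := sigma01.
have tau0 : 0 < 1 - sigma by rewrite subr_gt0.
have P0 : 0 < P by exact: lt_le_trans P1.
have C'0 : 0 < 1 + 2 * C by rewrite addr_gt0 ?mulr_gt0.
exists ((1 + 2 * C) `^ (1 - sigma)^-1); first exact: powR_gt0.
move=> u v k mv vk vu vP gu.
have v0 x : Omega x -> 0 <= v x by move/vk/andP => [].
pose ps := P / (1 - sigma).
have mpow a : measurable_fun Omega (fun x => v x `^ a).
  exact: (@measurableT_comp _ _ _ _ _ _ (@powR R ^~ a)).
have psP : 0 <= ps - P.
  by rewrite subr_ge0 /ps ler_peMr ?(ltW P0)// invf_ge1// lerBlDr lerDl ltW.
have Ifin : (\int[mu]_(x in Omega) (v x `^ ps)%:E < +oo)%E.
  apply: (@le_lt_trans _ _ ((k `^ (ps - P) + 1)%:E *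
      \int[mu]_(x in Omega) (v x `^ P)%:E)%E); last first.
    apply: (@le_lt_trans _ _ ((k `^ (ps - P) + 1)%:E * 1)%E); last by rewrite mule1 ltry.
    by rewrite lee_pmul2l// lte_fin ltr_wpDl ?powR_ge0.
  apply: le_integral_scale.
  - by rewrite ltr_wpDl ?powR_ge0.
  - by move=> x _; rewrite lee_fin powR_ge0.
  move=> x Ox; rewrite -EFinM lee_fin.
  have /andP[vx0 vxk] := vk _ Ox.
  have -> : v x `^ ps = v x `^ (ps - P) * v x `^ P.
    rewrite -powRD ?subrK//; apply/implyP => /eqP psz.
    by move: (divr_gt0 P0 tau0); rewrite -/ps psz ltxx.
  rewrite ler_wpM2r ?powR_ge0//; apply: (@le_trans _ _ (k `^ (ps - P))).
    by apply: ge0_ler_powR => //; rewrite nnegrE// (le_trans vx0).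
  by rewrite lerDl.
have I0 : (0 <= \int[mu]_(x in Omega) (v x `^ ps)%:E)%E.
  by apply: integral_ge0 => x _; rewrite lee_fin powR_ge0.
pose J := fine (\int[mu]_(x in Omega) (v x `^ ps)%:E).
have JE : (\int[mu]_(x in Omega) (v x `^ ps)%:E = J%:E)%E.
  by rewrite /J fineK// ge0_fin_numE.
pose K := Num.max 1 J.
have K1 : 1 <= K by rewrite le_max lexx.
have K0 : 0 < K by exact: lt_le_trans K1.
have JK : J <= K by rewrite le_max lexx orbT.
pose D := C * K `^ sigma.
have D0 : 0 < D by rewrite mulr_gt0 ?powR_gt0.
(* The pointwise bound reads [v ^ ps <= D * (1 + g)], and the 1 may not be integrable over [Omega].
   It is replaced by [v ^ P] where [v > 1], while [v ^ ps <= v ^ P] elsewhere. The remainder [h] is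
   at most [D * g] and is measurable, as additivity of the integral requires. *)
pose h x := Num.max (v x `^ ps - (1 + D) * v x `^ P) 0.
have h0 x : 0 <= h x by rewrite le_max lexx orbT.
have mh : measurable_fun Omega h.
  apply: measurable_maxr => //; apply: measurable_funB => //.
  exact: measurable_funM.
have hg : (\int[mu]_(x in Omega) (h x)%:E <= D%:E)%E.
  apply: (@le_trans _ _ (D%:E * gagliardo s Omega p u)%E); last first.
    by rewrite -[leRHS]mule1 lee_pmul2l// lte_fin.
  apply: le_integral_scale => //; first by move=> x _; rewrite lee_fin.
  move=> y Oy; set g := (X in (_ <= D%:E * X)%E).
  have g0 : (0 <= g)%E.
    by apply: integral_ge0 => x _; rewrite lee_fin; exact: gkernel_ge0.
  have [goo|gfin] := eqVneq g +oo%E.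
    by rewrite goo gt0_muley ?leey// lte_fin.
  have gE : g = (fine g)%:E by rewrite fineK// ge0_fin_numE// ltey.
  have fg0 : 0 <= fine g by exact: fine_ge0.
  rewrite gE -EFinM lee_fin ge_max mulr_ge0 ?(ltW D0)// andbT.
  have [v1|v1] := leP (v y) 1.
    apply: (@le_trans _ _ 0); last by rewrite mulr_ge0 ?(ltW D0).
    rewrite subr_le0 (@le_trans _ _ (v y `^ P))//; last first.
      by rewrite ler_peMl ?powR_ge0// lerDl ltW.
    have [->|vy0] := eqVneq (v y) 0.
      by rewrite !powR0 ?gt_eqF// /ps divr_gt0.
    apply: ger_powR; last by rewrite -subr_ge0.
    by rewrite v1 lt_neqAle eq_sym vy0 v0.
  have v1P : 1 <= v y `^ P.
    have : 1 `^ P <= v y `^ P.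
      by apply: ge0_ler_powR; rewrite ?nnegrE ?(ltW P0) ?(ltW v1) ?v0.
    by rewrite powR1.
  have := ptw u v y (1 + fine g) K mv v0 (fun x Ox => vu x y Ox Oy) Oy.
  rewrite lerDl => /(_ fg0).
  have -> : (\int[mu]_(x in Omega) (gkernel u y x)%:E)%E = (fine g)%:E by [].
  rewrite lee_fin lerDr => /(_ ler01 vP K1).
  rewrite -/ps JE lee_fin => /(_ JK).
  rewrite mulrA -/D => h1.
  have h2 : D <= D * v y `^ P by rewrite ler_peMr// ltW.
  have h3 : 0 <= v y `^ P by exact: powR_ge0.
  rewrite lerBlDr; apply: (le_trans h1); rewrite mulrDr mulr1 mulrDl mul1r.
  by rewrite addrC lerD2l (le_trans h2)// lerDr.
have JD : J <= 1 + D + D.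
  rewrite -lee_fin -JE.
  apply: (@le_trans _ _ (\int[mu]_(x in Omega)
      ((1 + D)%:E * (v x `^ P)%:E + (h x)%:E))%E).
    apply: le_lower_integral => x Ox; first by rewrite lee_fin powR_ge0.
    rewrite -EFinM -EFinD lee_fin -lerBlDl /h le_max lexx//.
  have D1 : 0 <= 1 + D by rewrite addr_ge0// ltW.
  rewrite ge0_integralD//=.
  - rewrite ge0_integralZl_EFin//; last 2 first.
    + by move=> x _; rewrite lee_fin powR_ge0.
    + exact/measurable_EFinP.
    rewrite [leRHS]EFinD leeD//.
    by rewrite -[leRHS]mule1 lee_wpmul2l// lee_fin.
  - by move=> x _; rewrite -EFinM lee_fin mulr_ge0 ?powR_ge0.
  - by apply/measurable_EFinP; exact: measurable_funM.
  - by move=> x _; rewrite lee_fin.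
  - exact/measurable_EFinP.
rewrite -/ps JE lee_fin (le_trans JK)//; apply: absorb_power => //.
(* This lets the additive 1 in [1 + 2 * D] be absorbed into the factor [K ^ sigma]. *)
have Ks1 : 1 <= K `^ sigma.
  have : 1 `^ sigma <= K `^ sigma.
    by apply: ge0_ler_powR; rewrite ?nnegrE ?(ltW sg0) ?(ltW K0).
  by rewrite powR1.
have D2 : (1 + 2 * C) * K `^ sigma = K `^ sigma + D + D by rewrite /D; ring.
rewrite ge_max D2; apply/andP; split.
  by rewrite (le_trans Ks1)// -addrA lerDl addr_ge0 ?(ltW D0).
by rewrite (le_trans JD)// !lerD2r.
Qed.

(** The truncations of [|u|] at height [k] have smaller increments than [u] and share one bound;
    monotone convergence passes it to [u]. *)
Lemma critical_bound : exists2 C : R, 0 < C &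
  forall u : 'rV[R]_N -> R, measurable_fun Omega u ->
  (\int[mu]_(x in Omega) (`|u x| `^ P)%:E <= 1)%E ->
  (gagliardo s Omega p u <= 1)%E ->
  (\int[mu]_(x in Omega) (`|u x| `^ (P / (1 - sigma)))%:E <= C%:E)%E.
Proof.
have [C C0 trunc] := truncation_bound.
exists C => // u mu_ uP gu.
have P0 : 0 < P by exact: lt_le_trans P1.
have tau0 : 0 < 1 - sigma by rewrite subr_gt0; case/andP: sigma01.
pose v (k : nat) x := Num.min `|u x| k%:R.
have mv k : measurable_fun Omega (v k).
  by apply: measurable_minr => //; exact: measurableT_comp.
have v0 k x : 0 <= v k x by rewrite le_min normr_ge0 ler0n.
pose f (k : nat) x := (v k x `^ (P / (1 - sigma)))%:E.
have ps0 : 0 <= P / (1 - sigma) by rewrite divr_ge0 ?ltW.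
have fE x : limn (f ^~ x) = (`|u x| `^ (P / (1 - sigma)))%:E.
  apply/cvg_lim => //; apply: cvg_near_cst.
  near=> k; rewrite /f /v min_l//; near: k.
  exact: nbhs_infty_ger.
under eq_integral do rewrite -fE.
rewrite monotone_convergence//; last 3 first.
- move=> k; apply/measurable_EFinP.
  exact: (@measurableT_comp _ _ _ _ _ _ (@powR R ^~ (P / (1 - sigma)))).
- by move=> k x _; rewrite lee_fin powR_ge0.
- move=> x _ k l kl; rewrite lee_fin; apply: ge0_ler_powR; rewrite ?nnegrE//.
  by rewrite le_min ge_min lexx /= ge_min ler_nat kl orbT.
apply: lime_le.
  apply: ereal_nondecreasing_is_cvgn => k l kl; apply: le_lower_integral => x _.
    by rewrite lee_fin powR_ge0.
  rewrite lee_fin; apply: ge0_ler_powR; rewrite ?nnegrE//.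
  by rewrite le_min ge_min lexx /= ge_min ler_nat kl orbT.
apply: nearW => k; apply: (trunc u (v k) k%:R) => //.
- by move=> x _; rewrite v0 ge_min lexx orbT.
- move=> x y _ _; apply: le_trans (ler_dist_dist _ _).
  exact: dist_min_le.
apply: le_trans uP; apply: le_lower_integral => x _.
  by rewrite lee_fin powR_ge0.
rewrite lee_fin; apply: ge0_ler_powR; rewrite ?nnegrE ?(ltW P0)//.
by rewrite ge_min lexx.
Unshelve. all: by end_near. Qed.

End critical_estimate.

(** * Consequences of the log-Hoelder condition *)

Section exponent_rigidity.
Context {R : realType} {N : nat}.
Implicit Types (Omega : set 'rV[R]_N) (x y : 'rV[R]_N).
Implicit Types p : 'rV[R]_N * 'rV[R]_N -> R.

Lemma enormZ (a : R) x : enorm (a *: x) = `|a| * enorm x.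
Proof.
rewrite /enorm; under eq_bigr do rewrite mxE exprMn.
by rewrite -mulr_sumr sqrtrM ?sqr_ge0// sqrtr_sqr.
Qed.

(* Since the radius [eps] of the log-Hoelder condition does not depend on the
   points, letting [y] tend to [x] turns it into this one-sided comparison. *)
Lemma diag_le_near Omega p : (0 < N)%N -> open Omega ->
  {within closure Omega `*` closure Omega, continuous p} ->
  (forall x y, Omega x -> Omega y -> 0 <= p (x, y)) ->
  log_hoelder Omega p ->
  exists2 e : R, 0 < e & forall x x' y', Omega x -> Omega x' -> Omega y' ->
    `|x - x'| < e -> `|x - y'| < e -> p (x, x) <= p (x', y').
Proof.
move=> N0 oO pC p0 /ereal_inf_lt[_ [eps /= eps0 <-]] supoo.
have n0 : 0 < N%:R :> R by rewrite ltr0n.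
have [M MP] : exists M : R, forall x y, Omega x -> Omega y ->
    0 < enorm (x - y) -> enorm (x - y) < 1 / 2 ->
    `|p (x, y) - inf (p @` ((eball x eps `&` Omega) `*` (eball y eps `&` Omega)))| *
     ln (1 / enorm (x - y)) <= M.
  have [M hM] : exists M : R, (log_hoelder_sup Omega p eps <= M%:E)%E.
    move: supoo; case: (log_hoelder_sup _ _ _) => // [r|] _.
      by exists r.
    by exists 0; rewrite leNye.
  exists M => x y Ox Oy xy0 xy1; rewrite -lee_fin; apply: le_trans hM.
  by apply: ereal_sup_ubound; exists (x, y).
(* The 2 is there because [y'] is compared with [y] through [x]; the [N] converts the sup norm into
   the Euclidean norm. *)
exists (eps / (2 * N%:R)); first by rewrite divr_gt0// mulr_gt0.
set e' := eps / (2 * N%:R).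
move=> x x' y' Ox Ox' Oy' xx' xy'; rewrite leNgt; apply/negP => lt_p.
pose d := p (x, x) - p (x', y').
have d0 : 0 < d by rewrite subr_gt0.
(* Chosen so that [d / 2 * B] exceeds [M]; the contradiction comes from a [y] so close to [x] that
   the logarithm is at least [B]. *)
pose B := 2 * (`|M| + 1) / d.
pose v : 'rV[R]_N := delta_mx ord0 (Ordinal N0).
have v1 : enorm v = 1 by exact: enorm_delta.
have pc : {for (x, x), continuous p}.
  have oOO : open (Omega `*` Omega).
    rewrite openE => -[a b] [/= Oa Ob]; exists (Omega, Omega) => //.
    by split; exact: open_nbhs_nbhs.
  have : {within Omega `*` Omega, continuous p}.
    apply: continuous_subspaceW pC => -[a b] [/= Oa Ob].
    by split; exact: subset_closure.
  by rewrite continuous_open_subspace//; apply; rewrite inE.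
have d20 : 0 < d / 2 by rewrite divr_gt0.
have /cvgrPdist_lt/(_ _ d20)/nbhs_ballP[eta /= eta0 etaP] :
  p z @[z --> (x, x)] --> p (x, x) by exact: pc.
have /nbhs_ballP[r /= r0 rO] : nbhs x Omega by exact: open_nbhs_nbhs.
have e'0 : 0 < e' by rewrite divr_gt0// mulr_gt0.
near (0 : R)^'+ => delta.
have delta0 : 0 < delta by near: delta; exact: nbhs_right_gt.
pose y := x + delta *: v.
have xyv : x - y = - (delta *: v) by rewrite /y opprD addNKr.
have xyE : enorm (x - y) = delta by rewrite xyv enormN enormZ v1 mulr1 gtr0_norm.
have xy_le : `|x - y| <= delta by rewrite -xyE norm_le_enorm.
have Oy : Omega y.
  apply: rO; rewrite ball_rVE /=; apply: (le_lt_trans xy_le).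
  by near: delta; exact: nbhs_right_lt.
have pxy : `|p (x, x) - p (x, y)| < d / 2.
  apply: etaP; split => /=; first exact: ballxx.
  rewrite ball_rVE /=; apply: (le_lt_trans xy_le).
  by near: delta; exact: nbhs_right_lt.
have delta2 : delta < 1 / 2 by near: delta; exact: nbhs_right_lt.
have deltae : delta < e' by near: delta; exact: nbhs_right_lt.
have deltaB : delta < expR (- B) by near: delta; apply: nbhs_right_lt; exact: expR_gt0.
have /= h := MP x y Ox Oy; move: h; rewrite xyE => /(_ delta0 delta2).
set I := inf _ => hI.
(* The pair [(x', y')] lies in the product of the balls around [x] and [y], so [p (x, y)] exceeds
   the infimum by at least [d / 2]. *)
have Ile : I <= p (x', y').
  apply: ge_inf.
    by exists 0 => _ [[a b] [[_ Oa] [_ Ob]] <-]; exact: p0.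
  exists (x', y') => //; split; split => //=; rewrite /eball/=.
    rewrite (le_lt_trans (enorm_le_norm _))// mulrC -ltr_pdivlMr//.
    rewrite distrC (lt_le_trans xx')// /e' invfM mulrA ler_pM2r ?invr_gt0//.
    by rewrite ler_pdivrMr// ler_pMr// ler1n.
  rewrite (le_lt_trans (enorm_le_norm _))// mulrC -ltr_pdivlMr//.
  have -> : eps / N%:R = e' + e'.
    by rewrite /e' invfM mulrA -mulrDl -splitr.
  rewrite (_ : y' - y = (y' - x) + (x - y)); last by rewrite addrA subrK.
  apply: (le_lt_trans (ler_normD _ _)); apply: ltrD; first by rewrite distrC.
  exact: le_lt_trans xy_le deltae.
have lnB : B <= ln (1 / delta).
  rewrite -[leLHS]expRK ler_ln ?posrE ?expR_gt0// ?divr_gt0//.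
  by rewrite div1r -[leLHS]invrK lef_pV2 ?posrE ?invr_gt0 ?expR_gt0// -expRN ltW.
have B0 : 0 < B by rewrite divr_gt0// mulr_gt0// ltr_wpDl.
have : d / 2 * B <= M.
  apply: le_trans hI; apply: ler_pM => //; [exact: ltW|exact: ltW|].
  apply: le_trans (ler_norm _); move: pxy; rewrite ltr_norml => /andP[_].
  by rewrite /d in d0 d20 *; lra.
have -> : d / 2 * B = `|M| + 1 by rewrite /B; field; rewrite gt_eqF.
by have := ler_norm M; lra.
Unshelve. all: by end_near. Qed.

(** A level set is relatively open as a union of balls of radius [e], and relatively closed because
    the same balls around the other points avoid it. *)
Lemma locally_constant_connected (Omega : set 'rV[R]_N) (f : 'rV[R]_N -> R) (e : R) :
  connected Omega -> 0 < e ->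
  (forall x y, Omega x -> Omega y -> `|x - y| < e -> f x = f y) ->
  forall x y, Omega x -> Omega y -> f x = f y.
Proof.
move=> cO e0 loc x y Ox Oy.
pose B := [set z | Omega z /\ f z = f x].
suff : B = Omega by move=> BE; have : B y by [rewrite BE]; case.
have near_ball z : ball z e z by exact: ballxx.
apply: cO; first by exists x.
  exists (\bigcup_(z in B) ball z e);
    first by apply: bigcup_open => z _; exact: ball_open.
  apply/seteqP; split => [z Bz|z [Oz [w [Ow fw]]]].
    by split; [case: Bz|exists z].
  by rewrite ball_rVE /= => wz; split => //; rewrite -(loc w z).
exists (~` \bigcup_(z in Omega `\` B) ball z e).
  by apply: open_closedC; apply: bigcup_open => z _; exact: ball_open.
apply/seteqP; split => [z [Oz fz]|z [Oz nz]].
  split => // -[w [Ow nBw]]; rewrite ball_rVE /= => wz; apply: nBw; split => //.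
  by rewrite (loc w z).
by apply: contrapT => nBz; apply: nz; exists z.
Qed.

Lemma connected_setT_rV : connected [set: 'rV[R]_N].
Proof.
have -> : [set: 'rV[R]_N] = \bigcup_(x in [set: 'rV[R]_N])
    ((fun t : R => t *: x) @` `[0, 1]).
  apply/seteqP; split => // x _; exists x => //; exists 1; rewrite ?scale1r//=.
  by rewrite in_itv/= ler01 lexx.
apply: bigcup_connected.
  exists 0 => x _; exists 0; rewrite ?scale0r//=.
  by rewrite in_itv/= ler01 lexx.
move=> x _; apply: connected_continuous_connected; first exact: segment_connected.
by apply: continuous_subspaceT => t; exact: scalel_continuous.
Qed.

End exponent_rigidity.

(** * From modulars to norms *)

Section scaling.
Context {R : realType} {N : nat}.
Implicit Types (Omega : set 'rV[R]_N) (h q u : 'rV[R]_N -> R).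
Implicit Types p : 'rV[R]_N * 'rV[R]_N -> R.

(** A substitute for homogeneity, which variable exponents destroy: [b ^ (- h) <= b ^ (- 1)]
    uniformly in [h >= 1]. *)
Lemma powR_div_le (a b h : R) : 0 <= a -> 1 <= b -> 1 <= h ->
  (a / b) `^ h <= b^-1 * a `^ h.
Proof.
move=> a0 b1 h1; have b0 : 0 < b by exact: lt_le_trans b1.
rewrite mulrC; apply: ge1r_powRZ => //.
by rewrite invr_gt0 b0 invf_le1.
Qed.

Lemma modular_L_scale Omega h u (b : R) : (forall x, Omega x -> 1 <= h x) -> 1 <= b ->
  (modular_L Omega h (fun x => (u x / b)%R) <= b^-1%:E * modular_L Omega h u)%E.
Proof.
move=> h1 b1; have b0 : 0 < b by exact: lt_le_trans b1.
apply: le_integral_scale; first by rewrite invr_gt0.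
  by move=> x _; rewrite lee_fin powR_ge0.
move=> x Ox; rewrite -EFinM lee_fin normrM normfV (gtr0_norm b0).
by apply: powR_div_le => //; exact: h1.
Qed.

Lemma gagliardo_scale (s : R) Omega p u (b : R) :
  (forall x y, Omega x -> Omega y -> 1 <= p (x, y)) -> 1 <= b ->
  (gagliardo s Omega p (fun x => (u x / b)%R) <= b^-1%:E * gagliardo s Omega p u)%E.
Proof.
move=> p1 b1; have b0 : 0 < b by exact: lt_le_trans b1.
have bV0 : 0 < b^-1 by rewrite invr_gt0.
apply: le_integral_scale => // y Oy.
  by apply: integral_ge0 => x _; rewrite lee_fin divr_ge0 ?powR_ge0.
apply: le_integral_scale => // x Ox; first by rewrite lee_fin divr_ge0 ?powR_ge0.
rewrite -EFinM lee_fin mulrA ler_wpM2r ?invr_ge0 ?powR_ge0//.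
rewrite -mulrBl normrM normfV (gtr0_norm b0).
by apply: powR_div_le => //; exact: p1.
Qed.

Lemma modular_L_ge0 Omega h u : (0 <= modular_L Omega h u)%E.
Proof. by apply: integral_ge0 => x _; rewrite lee_fin powR_ge0. Qed.

Lemma gagliardo_ge0 (s : R) Omega p u : (0 <= gagliardo s Omega p u)%E.
Proof.
apply: integral_ge0 => y _; apply: integral_ge0 => x _.
by rewrite lee_fin divr_ge0 ?powR_ge0.
Qed.

Lemma modular_W_ge0 (s : R) Omega p u : (0 <= modular_W s Omega p u)%E.
Proof. exact: adde_ge0 (modular_L_ge0 _ _ _) (gagliardo_ge0 _ _ _ _). Qed.

(** A modular bound on the unit ball suffices: dividing further by [C] brings the target modular
    below 1, as the Luxemburg norm demands. *)
Lemma imbedding_of_modular_bound (s : R) Omega p q (C Q : R) : measurable Omega ->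
  (forall x y, Omega x -> Omega y -> 1 <= p (x, y)) ->
  (forall x, Omega x -> 1 <= q x <= Q) -> 1 <= C ->
  (forall u, measurable_fun Omega u -> (modular_W s Omega p u < 1)%E ->
    (modular_L Omega q u <= C%:E)%E) ->
  continuous_imbedding (Wvar s Omega p) (Wvar_norm s Omega p)
                       (Lvar Omega q) (Lvar_norm Omega q).
Proof.
move=> mO p1 qQ C1 bound.
have C0 : 0 < C by exact: lt_le_trans C1.
have mscale u (b : R) : measurable_fun Omega u -> measurable_fun Omega (fun x => u x / b).
  by move=> mu; exact: measurable_funM.
have unit_scale u : Wvar s Omega p u -> exists b : R, 1 <= b /\
    (modular_W s Omega p (fun x => (u x / b)%R) < 1)%E.
  move=> [[mu uL] uG].
  have Wfin : (modular_W s Omega p u)%E \is a fin_num.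
    rewrite (ge0_fin_numE (modular_W_ge0 _ _ _ _)).
    exact: lte_add_pinfty.
  pose M := fine (modular_W s Omega p u).
  have M0 : 0 <= M by apply: fine_ge0; exact: modular_W_ge0.
  have M1 : 1 <= M + 1 by rewrite lerDr.
  (* The scaled modular is at most [M / (M + 1)], hence strictly below 1. *)
  exists (M + 1); split=> //; rewrite /=.
  apply: (@le_lt_trans _ _ ((M + 1)^-1%:E * modular_W s Omega p u)%E).
    rewrite ge0_muleDr; [|exact: modular_L_ge0|exact: gagliardo_ge0].
    apply: leeD.
      by apply: modular_L_scale => // x Ox; exact: p1.
    exact: gagliardo_scale.
  rewrite -(fineK Wfin) -/M -EFinM lte_fin mulrC ltr_pdivrMr ?(lt_le_trans _ M1)//.
  by rewrite mul1r ltrDl.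
split => [u uW|].
  have [b [b1 ub]] := unit_scale u uW.
  have b0 : 0 < b by exact: lt_le_trans b1.
  have [[mu _] _] := uW; split => //.
  (* Undoing the division by [b >= 1] costs at most [b ^ Q], since [q] is bounded by [Q]. *)
  apply: (@le_lt_trans _ _ ((b `^ Q)%:E * modular_L Omega q (fun x => (u x / b)%R))%E).
    apply: le_integral_scale; first exact: powR_gt0.
      by move=> x _; rewrite lee_fin powR_ge0.
    move=> x Ox; have /andP[q1 qle] := qQ x Ox.
    rewrite -EFinM lee_fin -[X in X `^ _](divfK (lt0r_neq0 b0) `|u x|).
    rewrite normrM normfV (gtr0_norm b0) powRM ?divr_ge0 ?(ltW b0)//.
    by rewrite mulrC ler_wpM2r ?powR_ge0// ler_powR.
  have := bound _ (mscale _ b mu) ub; case: modular_L => // r; last first.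
    by rewrite mulrNy gtr0_sg ?powR_gt0// mul1e.
  by rewrite -EFinM ltry.
exists C; split => // u uW.
have [[mu _] _] := uW.
rewrite mulrC -ler_pdivrMr//; apply: lb_le_inf.
  have [b [b1 ub]] := unit_scale u uW.
  by exists b; split => //; exact: lt_le_trans b1.
(* Each [b] admissible in the infimum for the source norm makes [b * C] admissible for the target
   norm. *)
move=> b [b0 ub]; rewrite ler_pdivrMr//; apply: ge_inf.
  by exists 0 => z [/ltW].
split; first exact: mulr_gt0.
rewrite (_ : (fun x => _) = (fun x => u x / b / C)); last first.
  by apply/funext => x; rewrite -mulrA -invfM.
apply: (@le_trans _ _ (C^-1%:E * modular_L Omega q (fun x => (u x / b)%R))%E).
  by apply: modular_L_scale => // x /qQ/andP[].
rewrite lee_pdivrMl// mule1.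
by apply: bound => //; exact: mscale.
Qed.

End scaling.

(** * Assembly of the imbedding from the constancy of the diagonal exponent *)

Theorem theorem3p3 (R : realType) (N : nat) (Omega : set 'rV[R]_N) (s : R)
    (p : 'rV[R]_N * 'rV[R]_N -> R) (q : 'rV[R]_N -> R)
    (hN : (0 < N)%N)
    (hOmega : bounded_lipschitz_domain Omega \/ Omega = setT)
    (hs : 0 < s < 1)
    (hpC : {within closure Omega `*` closure Omega, continuous p})
    (hpU : unif_continuous (p : subspace (closure Omega `*` closure Omega) -> R))
    (hpS : forall x y, closure Omega x -> closure Omega y -> p (x, y) = p (y, x))
    (hpinf : (1%:E <
       ereal_inf [set (p z)%:E | z in closure Omega `*` closure Omega])%E)
    (hpsup : (ereal_sup [set (p z)%:E | z in closure Omega `*` closure Omega] <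
       (N%:R / s)%:E)%E)
    (hplog : log_hoelder Omega p)
    (hqC : Cplus Omega q)
    (hqcrit : forall x, Omega x -> exists2 eps : R, 0 < eps &
       let B := eball x eps `&` Omega in
       let pB := inf (p @` (B `*` B)) in
       sup (q @` B) <= N%:R * pB / (N%:R - s * pB))
    (hqT : Omega = setT ->
       unif_continuous q /\ forall x, p (x, x) < q x) :
  continuous_imbedding (Wvar s Omega p) (Wvar_norm s Omega p)
                       (Lvar Omega q) (Lvar_norm Omega q).
Proof.
have /andP[s0 _] := hs.
have n0 : 0 < N%:R :> R by rewrite ltr0n.
have [oO cO [x0 Ox0]] : domain Omega.
  case: hOmega => [[]//|->]; split; [exact: openT|exact: connected_setT_rV|].
  by exists 0.
have mO := measurable_open_rV oO.
have cork : corkscrew Omega.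
  by case: hOmega => [/corkscrew_lipschitz//|->]; exact: corkscrewT.
have p1 x y : Omega x -> Omega y -> 1 <= p (x, y).
  move=> Ox Oy; rewrite -lee_fin ltW// (lt_le_trans hpinf)//.
  by apply: ereal_inf_lbound; exists (x, y) => //; split; exact: subset_closure.
have [_ qinf qsup] := hqC.
have q1 x : Omega x -> 1 <= q x.
  move=> Ox; rewrite -lee_fin ltW// (lt_le_trans qinf)//.
  by apply: ereal_inf_lbound; exists x => //; exact: subset_closure.
have [Q qQ] : exists Q : R, forall x, Omega x -> q x <= Q.
  have qle x : Omega x -> ((q x)%:E <= ereal_sup [set (q x)%:E | x in closure Omega])%E.
    by move=> Ox; apply: ereal_sup_ubound; exists x => //; exact: subset_closure.
  move: qsup qle; case: (ereal_sup _) => // [r _ h|_ h].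
    by exists r => x /h; rewrite lee_fin.
  by exists 0 => x /h; rewrite leeNy_eq.
have [e e0 ple] := diag_le_near hN oO hpC
  (fun x y Ox Oy => le_trans ler01 (p1 x y Ox Oy)) hplog.
set P := p (x0, x0).
(* The one-sided comparison, used in both directions between nearby points, makes the diagonal
   exponent locally constant. *)
have diagE x : Omega x -> p (x, x) = P.
  move=> Ox; apply: (locally_constant_connected (f := fun x => p (x, x)) cO e0) => //.
  move=> y z Oy Oz yz; apply/eqP; rewrite eq_le; apply/andP; split; apply: ple => //.
    by rewrite distrC.
  by rewrite distrC.
have Pp x y : Omega x -> Omega y -> enorm (x - y) < e -> P <= p (x, y).
  move=> Ox Oy xy; rewrite -(diagE y Oy); apply: ple => //; last first.
    by rewrite subrr normr0.
  by rewrite distrC (le_lt_trans (norm_le_enorm _)).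
have P1 : 1 <= P by exact: p1.
have P0 : 0 < P by exact: lt_le_trans P1.
have sPN : s * P < N%:R.
  rewrite mulrC -ltr_pdivlMr// -lte_fin (le_lt_trans _ hpsup)//.
  by apply: ereal_sup_ubound; exists (x0, x0) => //; split; exact: subset_closure.
pose ps := P / (1 - s * P / N%:R).
have psE : ps = N%:R * P / (N%:R - s * P).
  have NsP : N%:R - s * P != 0 by rewrite subr_eq0 gt_eqF.
  by rewrite /ps; field; rewrite NsP (gt_eqF n0).
(* The infimum of [p] near [x] is at most [p (x, x) = P], and [N p / (N - s p)] increases with
   [p]. *)
have qps x : Omega x -> q x <= ps.
  move=> Ox; have [eps eps0 /=] := hqcrit x Ox.
  set B := _ `&` _; set pB := inf _ => qB.
  have Bx : B x.
    split=> //=; rewrite /eball /= (le_lt_trans (enorm_le_norm _))//.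
    by rewrite subrr normr0 mulr0.
  have pBP : pB <= P.
    rewrite -(diagE x Ox); apply: ge_inf; last by exists (x, x).
    by exists 1 => _ [[a b] [[_ Oa] [_ Ob]] <-]; exact: p1.
  have pB1 : 1 <= pB.
    apply: lb_le_inf; first by exists (p (x, x)), (x, x).
    by move=> _ [[a b] [[_ Oa] [_ Ob]] <-]; exact: p1.
  have spB : s * pB <= s * P by rewrite ler_wpM2l// ltW.
  apply: (@le_trans _ _ (sup (q @` B))).
    apply: ub_le_sup; last by exists x.
    by exists Q => _ [y [_ Oy] <-]; exact: qQ.
  apply: (le_trans qB); rewrite psE; apply: ler_pM.
  - by rewrite mulr_ge0// (le_trans ler01).
  - by rewrite invr_ge0 subr_ge0 ltW// (le_lt_trans spB).
  - by rewrite ler_wpM2l.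
  by rewrite lef_pV2 ?posrE ?subr_gt0 ?(le_lt_trans spB)// lerB.
have [C C0 crit] := critical_bound hN mO cork s0 P1 sPN e0 Pp.
(* The two kinds of domain part ways here. On a bounded one, [|w| ^ q <= 1 + |w| ^ ps] and [D]
   bounds the volume; on the whole space [P <= q <= ps] gives [|w| ^ q <= |w| ^ P + |w| ^ ps] and
   [D] is 1. *)
have [D D0 qD] : exists2 D : R, 0 <= D & forall w : 'rV[R]_N -> R,
    measurable_fun Omega w ->
    (\int[lebesgue_measure_rV]_(x in Omega) (`|w x| `^ P)%:E <= 1)%E ->
    (\int[lebesgue_measure_rV]_(x in Omega) (`|w x| `^ ps)%:E <= C%:E)%E ->
    (modular_L Omega q w <= D%:E + C%:E)%E.
  have mpow (w : 'rV[R]_N -> R) (a : R) : measurable_fun Omega w ->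
      measurable_fun Omega (fun x => (`|w x| `^ a)%:E).
    move=> mw; apply/measurable_EFinP.
    apply: (@measurableT_comp _ _ _ _ _ _ (@powR R ^~ a)) => //.
    exact: measurableT_comp.
  have pow_ge0 (w : 'rV[R]_N -> R) (a : R) x : (0 <= (`|w x| `^ a)%:E)%E.
    by rewrite lee_fin powR_ge0.
  case: hOmega => [[_ [M OM] _]|OT].
    have OB : Omega `<=` ball 0 (`|M| + 1).
      move=> x /OM; rewrite /eball /= subr0 => xM.
      rewrite ball_rVE /= sub0r normrN (le_lt_trans (norm_le_enorm _))//.
      by rewrite (lt_le_trans xM)// (le_trans (ler_norm M))// lerDl.
    pose V : R := (2 * (`|M| + 1)) ^+ N.
    have V0 : 0 <= V by rewrite exprn_ge0// mulr_ge0// addr_ge0.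
    have OV : (lebesgue_measure_rV Omega <= V%:E)%E.
      rewrite /V -(@lebesgue_measure_rV_ball _ _ 0) ?ltr_wpDl//.
      by rewrite le_measure ?inE//; exact: measurable_ball_rV.
    exists V => // w mw _ wps.
    apply: (@le_trans _ _ (\int[lebesgue_measure_rV]_(x in Omega)
        (cst 1%E x + (`|w x| `^ ps)%:E))%E).
      apply: le_lower_integral => x Ox; first exact: pow_ge0.
      rewrite -EFinD lee_fin; apply: powR_le1D; rewrite ?qps//.
      by rewrite (le_trans ler01)// q1.
    rewrite ge0_integralD//=; last exact: mpow.
    by rewrite leeD// integral_cst// mul1e.
  have [_ pq] := hqT OT.
  exists 1 => // w mw wP wps.
  apply: (@le_trans _ _ (\int[lebesgue_measure_rV]_(x in Omega)
      ((`|w x| `^ P)%:E + (`|w x| `^ ps)%:E))%E).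
    apply: le_lower_integral => x Ox; first exact: pow_ge0.
    have Pq : P <= q x by rewrite -(diagE x Ox) ltW.
    rewrite -EFinD lee_fin.
    have [w1|w1] := leP `|w x| 1.
      apply: (@le_trans _ _ (`|w x| `^ P)); last by rewrite lerDl powR_ge0.
      have [->|w_neq0] := eqVneq `|w x| 0.
        by rewrite !powR0 ?gt_eqF// (lt_le_trans P0).
      by apply: ger_powR => //; rewrite w1 lt_neqAle eq_sym w_neq0 normr_ge0.
    apply: (@le_trans _ _ (`|w x| `^ ps)); last by rewrite lerDr powR_ge0.
    by apply: ler_powR; rewrite ?qps// ltW.
  rewrite ge0_integralD//=; [|exact: mpow|exact: mpow].
  exact: leeD.
(* The extra 1 ensures that the constant is at least 1. *)
apply: (@imbedding_of_modular_bound _ _ s Omega p q (D + C + 1) Q) => //.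
- by move=> x Ox; rewrite q1//= qQ.
- by rewrite lerDr addr_ge0// ltW.
move=> w mw wW.
have wL1 : (modular_L Omega (diag p) w <= 1)%E.
  by apply: le_trans (ltW wW); rewrite leeDl// gagliardo_ge0.
have wG1 : (gagliardo s Omega p w <= 1)%E.
  by apply: le_trans (ltW wW); rewrite leeDr// modular_L_ge0.
have wP : (\int[lebesgue_measure_rV]_(x in Omega) (`|w x| `^ P)%:E <= 1)%E.
  rewrite (eq_integral (fun x => (`|w x| `^ diag p x)%:E))// => x.
  by rewrite inE => Ox; rewrite /diag diagE.
apply: (le_trans (qD w mw wP (crit w mw wP wG1))).
by rewrite -EFinD lee_fin lerDl.
Qed.
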